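(* Let $C\subset\mathbb{R}^2$ be an $o$-symmetric plane convex body, and let $x,y,z\in\mathbb{R}^2$ be points such that each pair of them has a $C$-arc-distance (i.e. each pair is at $C$-distance at most two). (1) If $y\in\operatorname{int}[x,z]_C$, then $\rho_C(x,y)+\rho_C(y,z)\le\rho_C(x,z)$. (2) If $y\in\operatorname{bd}[x,z]_C$, then $\rho_C(x,y)+\rho_C(y,z)=\rho_C(x,z)$. (3) If $y\notin[x,z]_C$ and $C$ is smooth, then $\rho_C(x,y)+\rho_C(y,z)\ge\rho_C(x,z)$.
   Context: A plane convex body is a compact convex set in $\mathbb{R}^2$ with non-empty interior; $o$-symmetric means $C=-C$; smooth means that there is a unique supporting line at each boundary point. The $C$-distance of two points is their distance in the norm with unit ball $C$. The $C$-length of a polygonal curve is the sum of the $C$-distances of consecutive vertices, and the $C$-length of a curve is the supremum of the $C$-lengths of polygonal curves whose vertices are chosen (in order) from the curve. For points $p,q$ at $C$-distance at most two, the arc-distance $\rho_C(p,q)$ is the minimum of the $C$-lengths of the arcs with endpoints $p$ and $q$ that are contained in $\operatorname{bd}(v+C)$ for some $v\in\mathbb{R}^2$. The $C$-spindle $[p,q]_C$ is the intersection of all translates of $C$ that contain both $p$ and $q$ (and $\mathbb{R}^2$ if there is no such translate). *)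

(* Defs.v *)
From mathcomp Require Export all_boot all_order all_algebra.
From mathcomp Require Export all_classical all_reals all_analysis.
Export Order.TTheory GRing.Theory Num.Theory.
Export numFieldNormedType.Exports.

Set Implicit Arguments.
Unset Strict Implicit.
Unset Printing Implicit Defensive.

Local Open Scope classical_set_scope.
Local Open Scope ring_scope.

Section Defs.
Context {R : realType}.
Local Notation plane := 'rV[R]_2.
Implicit Types (C A l : set plane) (p q u v : plane).

Definition bd A : set plane := closure A `\` A°.

Definition translate v C : set plane := [set v + c | c in C].

Definition plane_convex_body C : Prop :=
  [/\ compact C, convex_set C & C° !=set0].

Definition o_symmetric C : Prop := C = [set - c | c in C].

Definition dot u p : R := \sum_(i < 2) u 0 i * p 0 i.

Definition supporting_line C p l : Prop :=
  exists u : plane, [/\ u != 0,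
    l = [set w | dot u w = dot u p] &
    forall c, C c -> dot u c <= dot u p].

Definition smooth C : Prop :=
  forall p, bd C p -> exists! l, supporting_line C p l.

(* The Minkowski functional of [C]: the norm with unit ball [C] when [C] is an
   o-symmetric convex body. *)
Definition Cnorm C u : R := inf [set t : R | 0 < t /\ C (t^-1 *: u)].

Definition Cdist C p q : R := Cnorm C (p - q).

Definition polygonal_length C (vs : seq plane) : R :=
  \sum_(i < (size vs).-1) Cdist C vs`_i vs`_i.+1.

(* The C-length of the curve parametrized by the restriction of [g] to
   [[a, b]], possibly infinite. *)
Definition curve_length C (g : R -> plane) (a b : R) : \bar R :=
  ereal_sup [set (polygonal_length C [seq g t | t <- ts])%:E
            | ts in [set ts : seq R | sorted <=%R ts /\
                                      {subset ts <= `[a, b]}]].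

(* [g] restricted to [[a, b]] parametrizes an arc with endpoints [p] and [q].
   [a = b] is allowed, so that the one-point set [[set p]] is a (degenerate)
   arc with endpoints [p] and [p], and it is the only such arc. *)
Definition arc_param (g : R -> plane) (a b : R) p q : Prop :=
  [/\ a <= b, {within `[a, b], continuous g},
      {in `[a, b] &, injective g}, g a = p & g b = q].

(* The infimum over an empty family of arcs is [+oo]; this is the value when
   the C-distance of [p] and [q] exceeds two. *)
Definition arc_distance C p q : \bar R :=
  ereal_inf [set L : \bar R | exists v g a b,
    [/\ arc_param g a b p q,
        g @` `[a, b] `<=` bd (translate v C) &
        L = curve_length C g a b]].

(* The whole plane when no translate of [C] contains both [p] and [q]. *)
Definition spindle C p q : set plane :=
  \bigcap_(v in [set v | translate v C p /\ translate v C q]) translate v C.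

End Defs.

(* Main.v *)
Require Import Defs.
From mathcomp Require Import ring lra.

Local Open Scope classical_set_scope.
Local Open Scope ring_scope.

(* Let [G] run through [bd C] by the angle.  Since [C = - C], the arcs that
   realize arc-distances from [p] to [q] are, up to translation, the arcs
   [G s .. G t] with [s <= t <= s + pi] and chord [G t - G s = q - p].  So every
   claim compares the lengths of arcs of [bd C] whose chords are [d1 := y - x],
   [d2 := z - y] and [d1 + d2].

   The basic comparison: if three arcs follow each other on a half circle and
   the chord of the middle one is the sum of the chords of the outer ones, then
   the middle arc is no longer than these two chords together, because each of
   its chords lies in the cone that they span.  Hence, if an arc contains two
   arcs whose chords add up to its own chord, then it is at least as long as
   these two together: pass to their union and intersection.

   If [y] lies in the spindle, then any arc with chord [d1 + d2] contains arcs
   with chords [d1] and [d2], by the intermediate value theorem.  If [y] is not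
   in the interior of the spindle, then, unless half of the circle is already
   covered, a translate of [C] contains the three points and has [y] on its
   boundary.  This puts the arcs for [d1] and [d2] on the two sides of [y]
   without overlap, and the comparison bounds the arc for [d1 + d2] by their
   sum. *)

Set Implicit Arguments.
Unset Strict Implicit.
Unset Printing Implicit Defensive.

Ltac vec := by apply/rowP => ?; rewrite !mxE; ring.

(** * Unit circles of plane norms *)

Definition det {R : realType} (p q : 'rV[R]_2) : R :=
  p 0 0 * q 0 1 - p 0 1 * q 0 0.

Section PlaneAlgebra.
Context {R : realType}.
Implicit Types p q r : 'rV[R]_2.

Lemma ord2P (i : 'I_2) : i = 0 \/ i = 1.
Proof. by case: i => -[|[|//]] hi; [left | right]; exact: val_inj. Qed.

(** Cramer's rule, cleared of denominators. *)
Lemma det_decomp p q r : det p q *: r = det r q *: p + det p r *: q.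
Proof.
by apply/rowP => i; rewrite !mxE /det; case: (ord2P i) => ->; ring.
Qed.

End PlaneAlgebra.

(* The unit circle of a norm, parametrized counterclockwise if [0 < ori] and
   clockwise if [ori < 0]; [len s t] is the length of the arc from [gam s] to
   [gam t].  As a least upper bound of the lengths of inscribed polygons it is
   at most the variation of any [F] whose increments dominate the chords. *)
Record circle (R : realType) := Circle {
  nrm : 'rV[R]_2 -> R;
  ori : R;
  gam : R -> 'rV[R]_2;
  len : R -> R -> \bar R;
  nrmD : forall p q, nrm (p + q) <= nrm p + nrm q;
  nrmZ : forall k p, nrm (k *: p) = `|k| * nrm p;
  nrm_eq0 : forall p, nrm p = 0 -> p = 0;
  nrm_continuous : continuous nrm;
  gam1 : forall t, nrm (gam t) = 1;
  gam_onto : forall p, nrm p = 1 -> exists t, p = gam t;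
  gam_continuous : continuous gam;
  gamDpi : forall t, gam (t + pi) = - gam t;
  gam_ori : forall s t, s < t < s + pi -> 0 < ori * det (gam s) (gam t);
  len_add : forall s r t, s <= r <= t -> len s t = (len s r + len r t)%E;
  len_ge : forall s t, s <= t -> ((nrm (gam t - gam s))%:E <= len s t)%E;
  lenDpi : forall s t, s <= t -> len (s + pi) (t + pi) = len s t;
  len_le : forall s t (F : R -> R), s <= t ->
    (forall r r', s <= r -> r <= r' -> r' <= t ->
      nrm (gam r' - gam r) <= F r' - F r) ->
    (len s t <= (F t - F s)%:E)%E
}.

Section CircleTheory.
Context {R : realType} (S : circle R).
Local Notation N := (nrm S).
Local Notation G := (gam S).
Implicit Types (p q a b d : 'rV[R]_2).

Definition cross p q := ori S * det p q.
Definition chord s t := G t - G s.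
Local Notation c s t := (cross (G s) (G t)).

Lemma crossDl p q r : cross (p + q) r = cross p r + cross q r.
Proof. by rewrite /cross /det !mxE; ring. Qed.
Lemma crossDr p q r : cross r (p + q) = cross r p + cross r q.
Proof. by rewrite /cross /det !mxE; ring. Qed.
Lemma crossZl k p q : cross (k *: p) q = k * cross p q.
Proof. by rewrite /cross /det !mxE; ring. Qed.
Lemma crossZr k p q : cross p (k *: q) = k * cross p q.
Proof. by rewrite /cross /det !mxE; ring. Qed.
Lemma crossNl p q : cross (- p) q = - cross p q.
Proof. by rewrite /cross /det !mxE; ring. Qed.
Lemma crossNr p q : cross p (- q) = - cross p q.
Proof. by rewrite /cross /det !mxE; ring. Qed.
Lemma crossC p q : cross q p = - cross p q.
Proof. by rewrite /cross /det; ring. Qed.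
Lemma crosspp p : cross p p = 0.
Proof. by rewrite /cross /det; ring. Qed.
Lemma cross0l p : cross 0 p = 0.
Proof. by rewrite /cross /det !mxE; ring. Qed.
Lemma cross0r p : cross p 0 = 0.
Proof. by rewrite /cross /det !mxE; ring. Qed.
Definition crossE := (crossDl, crossDr, crossNl, crossNr, crossZl, crossZr,
  crosspp, cross0l, cross0r).

Lemma cross_decomp p q r : cross p q *: r = cross r q *: p + cross p r *: q.
Proof. by rewrite /cross -!scalerA -scalerDr det_decomp. Qed.

Lemma cross_solve p q r : cross p q != 0 ->
  r = (cross r q / cross p q) *: p + (cross p r / cross p q) *: q.
Proof.
move=> h; apply: (scalerI h); rewrite cross_decomp scalerDr !scalerA.
by congr (_ *: _ + _ *: _); field.
Qed.

Lemma nrmN p : N (- p) = N p.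
Proof. by rewrite -scaleN1r nrmZ normrN normr1 mul1r. Qed.
Lemma nrm0 : N 0 = 0.
Proof. by rewrite -(scale0r (0 : 'rV[R]_2)) nrmZ normr0 mul0r. Qed.
Lemma nrmB p q : N (p - q) <= N p + N q.
Proof. by rewrite -(nrmN q) nrmD. Qed.
Lemma nrmBC p q : N (p - q) = N (q - p).
Proof. by rewrite -nrmN opprB. Qed.
Lemma nrm_ge0 p : 0 <= N p.
Proof. by have := nrmB p p; rewrite subrr nrm0; lra. Qed.
Lemma nrmZp k p : 0 <= k -> N (k *: p) = k * N p.
Proof. by move=> k0; rewrite nrmZ ger0_norm. Qed.

Section Triple.
Variables (u w : 'rV[R]_2) (al be : R).
Hypotheses (u1 : N u = 1) (w1 : N w = 1) (al0 : 0 <= al) (be0 : 0 <= be).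
Let v := al *: u + be *: w.
Hypothesis v1 : N v = 1.

(** The three triangle inequalities between [v], [al *: u] and [be *: w]. *)
Lemma triple_ineq : [/\ 1 <= al + be, al <= 1 + be & be <= 1 + al].
Proof.
split.
- by have := nrmD S (al *: u) (be *: w); rewrite -/v v1 !nrmZp // u1 w1 !mulr1.
- have := nrmB v (be *: w).
  by rewrite (_ : v - be *: w = al *: u) ?v1 ?nrmZp // ?u1 ?w1 ?mulr1 // addrK.
- have := nrmB v (al *: u).
  rewrite (_ : v - al *: u = be *: w) ?v1 ?nrmZp // ?u1 ?w1 ?mulr1 //.
  by rewrite /v addrC addKr.
Qed.

(** Scaling by [be] eliminates [w]; the triangle inequality for [u] and [v] together with
    [triple_ineq] then suffices. For [be = 0] nothing can be divided out, and the bound is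
    direct. *)
Lemma triple_out : 1 <= N (u + v - w).
Proof.
have [h1 h2 h3] := triple_ineq.
have h : (al + be) - `|1 - be| <= N (be *: (u + v - w)).
  have -> : be *: (u + v - w) = (al + be) *: u - (1 - be) *: v by rewrite /v; vec.
  have := nrmD S ((al + be) *: u - (1 - be) *: v) ((1 - be) *: v).
  rewrite subrK nrmZp ?addr_ge0 // u1 nrmZ v1; lra.
move: h; rewrite nrmZp //.
have [b1|b1] := leP be 1; last by rewrite ler0_norm; nra.
rewrite ger0_norm ?subr_ge0 //.
have [bp|] := ltP 0 be; first by move=> h; rewrite -(ler_pM2l bp); lra.
move=> b0 _; have bz : be = 0 by apply/le_anti; rewrite b0 be0.
have -> : u + v - w = (1 + al) *: u - w by rewrite /v bz; vec.
have := nrmD S ((1 + al) *: u - w) w.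
rewrite subrK nrmZp ?addr_ge0 // u1 w1; lra.
Qed.

(** The vector, or a multiple of it, is written through each two of [u], [v], [w]. Which of the
    three bounds suffices depends on how [al] and [be] compare with 1 and with each other. *)
Lemma triple_in : N (u - v + w) <= 1.
Proof.
have [h1 h2 h3] := triple_ineq.
have e0 : u - v + w = (1 - al) *: u + (1 - be) *: w by rewrite /v; vec.
have g0 : N (u - v + w) <= `|1 - al| + `|1 - be|.
  by rewrite e0 (le_trans (nrmD _ _ _)) // !nrmZ u1 w1 !mulr1.
have g1 : be * N (u - v + w) <= `|be - al| + `|1 - be|.
  rewrite -nrmZp // (_ : _ *: _ = (be - al) *: u + (1 - be) *: v); last by rewrite /v; vec.
  by rewrite (le_trans (nrmD _ _ _)) // !nrmZ u1 v1 !mulr1.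
have g2 : al * N (u - v + w) <= `|be - al| + `|1 - al|.
  rewrite -nrmZp // (_ : _ *: _ = (al - be) *: w + (1 - al) *: v); last by rewrite /v; vec.
  by rewrite (le_trans (nrmD _ _ _)) // !nrmZ w1 v1 !mulr1 (distrC al).
have [a1|a1] := leP al 1; have [b1|b1] := leP be 1.
- by move: g0; rewrite !ger0_norm; lra.
- by move: g0; rewrite ger0_norm ?ler0_norm; lra.
- by move: g0; rewrite ler0_norm ?ger0_norm; lra.
- have [ab|ab] := leP al be.
    move: g2; rewrite ger0_norm ?ler0_norm; try lra.
    move=> g2; rewrite -(ler_pM2l (lt_trans ltr01 a1)); lra.
  move: g1; rewrite !ler0_norm; try lra.
  move=> g1; rewrite -(ler_pM2l (lt_trans ltr01 b1)); lra.
Qed.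

End Triple.

Lemma gamBpi t : G (t - pi) = - G t.
Proof. by rewrite -[t in RHS](subrK pi) gamDpi opprK. Qed.

Lemma gamD2pi t : G (t + pi + pi) = G t.
Proof. by rewrite !gamDpi opprK. Qed.

Lemma cross_gam_gt0 s t : s < t -> t < s + pi -> 0 < c s t.
Proof. by move=> a b; apply: gam_ori; rewrite a. Qed.

Lemma cross_gam_ge0 s t : s <= t -> t <= s + pi -> 0 <= c s t.
Proof.
rewrite le_eqVlt => /predU1P[<- _|st]; first by rewrite crosspp.
rewrite le_eqVlt => /predU1P[->|ts]; first by rewrite gamDpi !crossE oppr0.
exact/ltW/cross_gam_gt0.
Qed.

Lemma chord_neq0 s t : s < t -> t <= s + pi -> chord s t != 0.
Proof.
move=> st; rewrite le_eqVlt => /predU1P[->|ts].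
  apply/eqP => /(congr1 N); rewrite nrm0 /chord gamDpi.
  rewrite (_ : - G s - G s = (- 2) *: G s); last by vec.
  by rewrite nrmZ gam1 normrN mulr1 ger0_norm //; lra.
apply/eqP => h; have := cross_gam_gt0 st ts.
by rewrite (_ : G t = G s) ?crosspp ?ltxx //; apply/eqP; rewrite -subr_eq0; apply/eqP.
Qed.

(** The coefficients are Cramer's quotients; the orientation of the circle makes them
    nonnegative. *)
Lemma arc_cone r0 r1 r2 : r0 <= r1 -> r1 <= r2 -> r0 < r2 -> r2 < r0 + pi ->
  exists al be, [/\ 0 <= al, 0 <= be, G r1 = al *: G r0 + be *: G r2,
    c r1 r2 = al * c r0 r2 & c r0 r1 = be * c r0 r2].
Proof.
move=> h01 h12 h02 h2; have p := cross_gam_gt0 h02 h2.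
exists (c r1 r2 / c r0 r2), (c r0 r1 / c r0 r2); split.
- by rewrite divr_ge0 ?(ltW p) // cross_gam_ge0 //; lra.
- by rewrite divr_ge0 ?(ltW p) // cross_gam_ge0 //; lra.
- by apply: cross_solve; rewrite gt_eqF.
- by rewrite divfK // gt_eqF.
- by rewrite divfK // gt_eqF.
Qed.

(** This is [triple_out] in the cone of the ends; a half circle, whose ends span no such cone, is
    treated directly. Geometrically, subtracting a chord of the arc from its starting point leads
    out of the open unit ball. *)
Lemma arc_out r0 r1 r2 : r0 <= r1 -> r1 <= r2 -> r2 <= r0 + pi ->
  1 <= N (G r0 + G r1 - G r2).
Proof.
move=> h01 h12 h2; have [h02|h02] := ltP r0 r2; last first.
  have -> : r1 = r0 by lra.
  by have -> : r2 = r0 by [lra]; rewrite addrK gam1.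
move: h2; rewrite le_eqVlt => /predU1P[->|h2].
  rewrite gamDpi opprK; have := nrmD S (G r0 + G r1 + G r0) (- G r1).
  rewrite (_ : _ + - G r1 = 2 *: G r0); last by vec.
  by rewrite nrmN nrmZp // !gam1; lra.
have [al [be [a0 b0 e _ _]]] := arc_cone h01 h12 h02 h2.
by rewrite e; apply: triple_out; rewrite ?gam1 // -e gam1.
Qed.

(** Likewise from [triple_in]. Geometrically, a chord of the arc moved to its starting point ends in
    the unit ball. *)
Lemma arc_in r0 r1 r2 : r0 <= r1 -> r1 <= r2 -> r2 <= r0 + pi ->
  N (G r0 - G r1 + G r2) <= 1.
Proof.
move=> h01 h12 h2; have [h02|h02] := ltP r0 r2; last first.
  have -> : r1 = r0 by lra.
  by have -> : r2 = r0 by [lra]; rewrite subrr add0r gam1.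
move: h2; rewrite le_eqVlt => /predU1P[->|h2].
  by rewrite gamDpi addrAC subrr add0r nrmN gam1.
have [al [be [a0 b0 e _ _]]] := arc_cone h01 h12 h02 h2.
by rewrite e; apply: triple_in; rewrite ?gam1 // -e gam1.
Qed.

(* Along the arc from [r1] to the antipode of [r0], the distance from the line
   through the points [r0] and [r1] does not decrease. *)
Lemma chord_turn r0 r1 r2 r3 : r0 <= r1 -> r1 <= r2 -> r2 <= r3 ->
  r3 <= r0 + pi -> 0 <= cross (chord r0 r1) (chord r2 r3).
Proof.
move=> h01 h12 h23 h3; have [h02|h02] := ltP r0 r2; last first.
  by rewrite (_ : r1 = r0) ?/chord ?subrr ?crossE //; lra.
have [h2|h2] := ltP r2 (r0 + pi); last first.
  by rewrite (_ : r3 = r2) ?/chord ?subrr ?crossE //; lra.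
have [al [be [a0 b0 e e1 e2]]] := arc_cone h01 h12 h02 h2.
(* [G r3] is expressed in the cone of [G r2] and [G (r0 + pi) = - G r0], so that both chords become
   combinations of the same vectors. *)
have h2' : r0 + pi < r2 + pi by lra.
have [al' [be' [a0' b0' e' e1' e2']]] := arc_cone h23 h3 h2 h2'.
have [i1 i2 i3] : [/\ 1 <= al + be, al <= 1 + be & be <= 1 + al].
  by apply: (triple_ineq (gam1 S r0) (gam1 S r2)) => //; rewrite -e gam1.
have [j1 j2 j3] : [/\ 1 <= al' + be', al' <= 1 + be' & be' <= 1 + al'].
  by apply: (triple_ineq (gam1 S r2) (gam1 S (r0 + pi))) => //; rewrite -e' gam1.
have -> : chord r2 r3 = (al' - 1) *: G r2 - be' *: G r0.
  by rewrite /chord e' gamDpi; vec.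
have -> : cross (chord r0 r1) ((al' - 1) *: G r2 - be' *: G r0) =
    (al' - 1) * (c r1 r2 - c r0 r2) + be' * c r0 r1.
  by rewrite /chord !crossE (crossC (G r1) (G r0)); ring.
rewrite e1 e2.
have -> : (al' - 1) * (al * c r0 r2 - c r0 r2) + be' * (be * c r0 r2) =
  ((al' - 1) * (al - 1) + be' * be) * c r0 r2 by ring.
rewrite mulr_ge0 ?(ltW (cross_gam_gt0 h02 _)) //.
(* [triple_ineq] gives [|al - 1| <= be] and [|al' - 1| <= be']. *)
have : `|(al' - 1) * (al - 1)| <= be' * be.
  by rewrite normrM ler_pM // ler_norml; apply/andP; split; lra.
by rewrite ler_norml => /andP[+ _]; lra.
Qed.

End CircleTheory.

(** * Arc lengths compared through chords *)

Section ArcLength.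
Context {R : realType} (S : circle R).
Local Notation N := (nrm S).
Local Notation G := (gam S).
Local Notation ell := (len S).
Local Notation cross := (cross S).
Local Notation chord := (chord S).
Local Notation c s t := (cross (G s) (G t)).
Implicit Types (p q a b d : 'rV[R]_2).

Lemma chordD r s t : chord r s + chord s t = chord r t.
Proof. by rewrite /chord; vec. Qed.

Lemma chordxx s : chord s s = 0.
Proof. by rewrite /chord subrr. Qed.

Lemma chord_le s t : s <= t -> ((N (chord s t))%:E <= ell s t)%E.
Proof. exact: len_ge. Qed.

Lemma len_ge0 s t : s <= t -> (0 <= ell s t)%E.
Proof. by move=> /chord_le; apply: le_trans; rewrite lee_fin nrm_ge0. Qed.

Lemma len_xx s : ell s s = 0%E.
Proof.
apply/le_anti; rewrite len_ge0 // andbT.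
have := @len_le _ S s s (fun=> 0) (lexx s); rewrite subrr; apply => r r' h1 h2 h3.
by rewrite (_ : r' = r) ?subrr ?nrm0 ?subr0 //; lra.
Qed.

(** The arc is a segment. The bound [F] for [len_le] is the position along it, [c s r / c s t],
    times the norm of the whole chord. *)
Lemma len_collinear s t : s <= t -> t <= s + pi ->
  (forall r r', s <= r -> r <= r' -> r' <= t -> cross (chord s t) (chord r r') = 0) ->
  (ell s t <= (N (chord s t))%:E)%E.
Proof.
rewrite le_eqVlt => /predU1P[<-|st ts col]; first by rewrite len_xx lee_fin nrm_ge0.
have k0 : 0 < c s t.
  (* A half circle violates the hypothesis: its chord is parallel to [G s], and its middle point is
     not on that line. *)
  move: ts; rewrite le_eqVlt => /predU1P[e|]; last exact: cross_gam_gt0.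
  have pi0 := pi_gt0 R.
  have hm : 0 < c s (s + pi / 2) by apply: cross_gam_gt0; lra.
  have : cross (chord s t) (chord s (s + pi / 2)) = 0 by apply: col; lra.
  rewrite e /chord gamDpi !crossE; lra.
have kn0 : cross (G s) (chord s t) = c s t by rewrite /chord !crossE subr0.
have dec e : cross (chord s t) e = 0 -> e = (cross (G s) e / c s t) *: chord s t.
  move=> h; rewrite [LHS](@cross_solve _ S (G s) (chord s t)) kn0 ?gt_eqF //.
  by rewrite crossC h oppr0 mul0r scale0r add0r.
have hF r r' : s <= r -> r <= r' -> r' <= t ->
    N (G r' - G r) <= c s r' / c s t * N (chord s t) - c s r / c s t * N (chord s t).
  move=> sr rr rt; have e := dec _ (col _ _ sr rr rt).
  have er : G r = G s + (cross (G s) (chord s r) / c s t) *: chord s t.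
    by rewrite -dec; [rewrite /chord; vec | apply: col => //; lra].
  have h : 0 <= cross (G s) (chord r r').
    have : 0 <= cross (G r) (chord r r') by rewrite /chord !crossE subr0 cross_gam_ge0 //; lra.
    by rewrite {1}e er crossZr crossDl crossZl crosspp kn0 mulr0 addr0 divfK ?gt_eqF.
  rewrite -/(chord r r') {1}e nrmZ ger0_norm ?divr_ge0 ?(ltW k0) //.
  by rewrite -mulrBl -mulrBl /chord crossDr crossNr.
have := len_le (ltW st) hF; rewrite crosspp mul0r mul0r subr0 divff ?mul1r //.
by rewrite gt_eqF.
Qed.

(* Chords of the first arc turn at most as far as those of the second one, so
   equal chords force the first arc to be a segment. *)
Lemma len_le_equal_chord r0 r1 r2 r3 : r0 <= r1 -> r1 <= r2 -> r2 <= r3 ->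
  r3 <= r0 + pi -> chord r0 r1 = chord r2 r3 -> (ell r0 r1 <= ell r2 r3)%E.
Proof.
move=> h01 h12 h23 h3 e; apply: le_trans (chord_le h23); rewrite -e.
apply: len_collinear => //; first lra.
move=> r r' h1 h2 h3'; rewrite e crossC.
have t x y : r0 <= x -> x <= y -> y <= r1 -> 0 <= cross (chord x y) (chord r2 r3).
  move=> *; apply: chord_turn; lra.
(* The chord splits into three parts with nonnegative cross products whose sum is zero, so each of
   them is zero. *)
have := t r0 r (lexx _) h1 (le_trans h2 h3').
have := t r' r1 (le_trans h1 h2) h3' (lexx _).
have := t _ _ h1 h2 h3'.
have := crosspp S (chord r2 r3); rewrite -{1}e -(chordD r0 r r1) -(chordD r r' r1) !crossDl; lra.
Qed.

(* If the chord of the middle arc is the sum of the chords [a] and [b] of the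
   outer ones, then the middle arc lies in the triangle with sides [a], [b]. *)
Lemma len_le_cone w0 m0 n0 n1 m1 w1 :
  w0 <= m0 -> m0 <= n0 -> n0 <= n1 -> n1 <= m1 -> m1 <= w1 -> w1 <= w0 + pi ->
  chord n0 n1 = chord w0 m0 + chord m1 w1 ->
  (ell n0 n1 <= (N (chord w0 m0) + N (chord m1 w1))%:E)%E.
Proof.
move=> h1 h2 h3 h4 h5 h6.
move ea : (chord w0 m0) => a; move eb : (chord m1 w1) => b e.
have ta x y : n0 <= x -> x <= y -> y <= n1 -> 0 <= cross a (chord x y).
  by move=> *; rewrite -ea; apply: chord_turn; lra.
have tb x y : n0 <= x -> x <= y -> y <= n1 -> 0 <= cross (chord x y) b.
  by move=> *; rewrite -eb; apply: chord_turn; lra.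
have : 0 <= cross a b by rewrite -ea -eb; apply: chord_turn; lra.
(* Parallel [a] and [b] make the triangle degenerate; the same splitting into three parts then shows
   that the arc is a segment. *)
rewrite le0r => /orP[/eqP ab|ab].
  apply: (@le_trans _ _ (N (chord n0 n1))%:E); last by rewrite lee_fin e nrmD.
  apply: len_collinear => //; first lra.
  move=> r r' k1 k2 k3.
  have ae : cross a (chord r r') = 0.
    have := ta _ _ (lexx _) k1 (le_trans k2 k3).
    have := ta _ _ (le_trans k1 k2) k3 (lexx _).
    have := ta _ _ k1 k2 k3.
    have : cross a (chord n0 n1) = 0 by rewrite e crossDr ab crosspp addr0.
    rewrite -(chordD n0 r n1) -(chordD r r' n1) !crossDr; lra.
  have be : cross (chord r r') b = 0.
    have := tb _ _ (lexx _) k1 (le_trans k2 k3).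
    have := tb _ _ (le_trans k1 k2) k3 (lexx _).
    have := tb _ _ k1 k2 k3.
    have : cross (chord n0 n1) b = 0 by rewrite e crossDl ab crosspp addr0.
    rewrite -(chordD n0 r n1) -(chordD r r' n1) !crossDl; lra.
  by rewrite e crossDl ae crossC be oppr0 addr0.
(* [F r] adds the coordinates of [G r] in the basis [a], [b], weighted by the norms of [a] and [b].
   Neither coordinate decreases along the arc. *)
have hF r r' : n0 <= r -> r <= r' -> r' <= n1 -> N (G r' - G r) <=
    (cross (G r') b / cross a b * N a + cross a (G r') / cross a b * N b) -
    (cross (G r) b / cross a b * N a + cross a (G r) / cross a b * N b).
  move=> k1 k2 k3; rewrite -/(chord r r').
  rewrite [chord r r'](@cross_solve _ S a b) ?gt_eqF // (le_trans (nrmD _ _ _)) //.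
  rewrite !nrmZp ?divr_ge0 ?ta ?tb ?(ltW ab) //.
  by rewrite [in leLHS]/chord !crossE; lra.
have := len_le h3 hF; congr (_ <= _%:E)%E.
have -> : G n1 = G n0 + (a + b) by rewrite -e /chord; vec.
by rewrite !crossE; field; rewrite gt_eqF.
Qed.

End ArcLength.

Section ArcComparison.
Context {R : realType} (S : circle R).
Local Notation G := (gam S).
Local Notation ell := (len S).
Local Notation cross := (cross S).
Local Notation chord := (chord S).
Implicit Types (p q d : 'rV[R]_2).

Lemma len_mono s s' t' t : s <= s' -> s' <= t' -> t' <= t ->
  (ell s' t' <= ell s t)%E.
Proof.
move=> h1 h2 h3; rewrite (@len_add _ S s s' t) ?h1; last lra.
rewrite (@len_add _ S s' t' t) ?h2 //.
rewrite (le_trans _ (leeDr _ (len_ge0 _ h1))) //.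
by rewrite leeDl // len_ge0.
Qed.

Lemma len_le_outer w0 m0 n0 n1 m1 w1 :
  w0 <= m0 -> m0 <= n0 -> n0 <= n1 -> n1 <= m1 -> m1 <= w1 -> w1 <= w0 + pi ->
  chord n0 n1 = chord w0 m0 + chord m1 w1 -> (ell n0 n1 <= ell w0 m0 + ell m1 w1)%E.
Proof.
move=> h1 h2 h3 h4 h5 h6 e; apply: le_trans (len_le_cone h1 h2 h3 h4 h5 h6 e) _.
by rewrite EFinD leeD // chord_le.
Qed.

Lemma chord_split w0 m0 n0 n1 m1 w1 : chord n0 n1 + chord m0 m1 = chord w0 w1 ->
  chord n0 n1 = chord w0 m0 + chord m1 w1.
Proof.
move=> e; apply: (addIr (chord m0 m1)); rewrite e -(chordD S w0 m0 w1) -(chordD S m0 m1 w1).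
by rewrite addrA addrAC.
Qed.

(** Disjoint arcs are immediate. Otherwise union and intersection have the same chord sum as the two
    arcs, and [len_le_outer] bounds the intersection by the two pieces outside of the union. *)
Lemma len_superadditive a0 a1 b0 b1 w0 w1 :
  w0 <= a0 -> a0 <= a1 -> a1 <= w1 -> w0 <= b0 -> b0 <= b1 -> b1 <= w1 ->
  w1 <= w0 + pi -> chord a0 a1 + chord b0 b1 = chord w0 w1 ->
  (ell a0 a1 + ell b0 b1 <= ell w0 w1)%E.
Proof.
wlog ab : a0 a1 b0 b1 / a0 <= b0.
  move=> th; have [ab|/ltW ab] := leP a0 b0; first exact: th.
  by move=> *; rewrite addeC; apply: th => //; rewrite addrC.
move=> h1 h2 h3 h4 h5 h6 h7 e.
have [d1|/ltW d1] := leP a1 b0.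
  rewrite (@len_add _ S w0 b0 w1); last lra.
  by apply: leeD; apply: len_mono; lra.
have [d2|/ltW d2] := leP b1 a1.
  rewrite (@len_add _ S w0 a0 w1); last lra.
  rewrite (@len_add _ S a0 a1 w1); last lra.
  rewrite addeCA leeD2l //; have e' := chord_split (etrans (addrC _ _) e).
  by apply: (len_le_outer _ _ _ _ _ _ e'); lra.
have hc : (ell b0 a1 <= ell w0 a0 + ell b1 w1)%E.
  have e' : chord b0 a1 = chord w0 a0 + chord b1 w1.
    by apply: chord_split; rewrite -e /chord; vec.
  by apply: (len_le_outer _ _ _ _ _ _ e'); lra.
rewrite (@len_add _ S w0 a0 w1); last lra.
rewrite (@len_add _ S a0 b1 w1); last lra.
rewrite (@len_add _ S a0 a1 b1); last lra.
rewrite (@len_add _ S b0 a1 b1); last lra.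
rewrite [leRHS](AC (1*(2*1)) (2*((1*4)*3))) /=.
by rewrite leeD2l // leeD2r.
Qed.

(* The part of the arc outside of the gap [[a1, b0]] lies in the two arcs, and
   the part inside is bounded by what the arc misses of them. *)
Lemma len_le_gap a0 a1 b0 b1 w0 w1 :
  a0 <= a1 -> a1 <= b0 -> b0 <= b1 -> b1 <= a0 + pi ->
  a0 <= w0 -> w0 <= w1 -> w1 <= b1 ->
  chord w0 w1 = chord a0 a1 + chord b0 b1 -> (ell w0 w1 <= ell a0 a1 + ell b0 b1)%E.
Proof.
move=> h1 h2 h3 h4 h5 h6 h7 e.
have e' : chord a1 b0 + chord w0 w1 = chord a0 b1.
  by rewrite e -(chordD S a0 a1 b1) -(chordD S a1 b0 b1) addrCA.
have p1 : (0 <= ell a0 a1)%E by exact: len_ge0.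
have p2 : (0 <= ell b0 b1)%E by exact: len_ge0.
have [d1|/ltW d1] := leP w1 a1.
  by rewrite (@le_trans _ _ (ell a0 a1)) // ?leeDl //; apply: len_mono.
have [d2|/ltW d2] := leP b0 w0.
  by rewrite (@le_trans _ _ (ell b0 b1)) // ?leeDr //; apply: len_mono.
have [d3|/ltW d3] := leP w0 a1; have [d4|/ltW d4] := leP w1 b0.
- rewrite (@len_add _ S w0 a1 w1); last lra.
  rewrite (@len_add _ S a0 w0 a1); last lra.
  rewrite addeC addeAC leeD2r //.
  have e2 : chord a1 w1 = chord a0 w0 + chord b0 b1.
    by apply: chord_split; rewrite -e' /chord; vec.
  by apply: (len_le_outer _ _ _ _ _ _ e2); lra.
- rewrite (@len_add _ S w0 a1 w1); last lra.
  rewrite (@len_add _ S a1 b0 w1); last lra.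
  rewrite (@len_add _ S a0 w0 a1); last lra.
  rewrite (@len_add _ S b0 w1 b1); last lra.
  rewrite [leRHS](AC (2*2) (2*((1*4)*3))) /= leeD2l // leeD2r //.
  have e2 : chord a1 b0 = chord a0 w0 + chord w1 b1 by apply: chord_split; rewrite -e'.
  by apply: (len_le_outer _ _ _ _ _ _ e2); lra.
- exact: len_le_outer.
- rewrite (@len_add _ S w0 b0 w1); last lra.
  rewrite (@len_add _ S b0 w1 b1); last lra.
  rewrite addeC [leRHS]addeCA leeD2l //.
  have e2 : chord w0 b0 = chord a0 a1 + chord w1 b1.
    by apply: chord_split; rewrite -e' /chord; vec.
  by apply: (len_le_outer _ _ _ _ _ _ e2); lra.
Qed.

End ArcComparison.

(** * Arcs with a given chord *)

Definition arc_of {R : realType} (S : circle R) d s t :=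
  [/\ s <= t, t <= s + pi & chord S s t = d].

Section Representatives.
Context {R : realType} (S : circle R).
Local Notation G := (gam S).
Local Notation ell := (len S).
Local Notation cross := (cross S).
Local Notation chord := (chord S).
Local Notation c s t := (cross (G s) (G t)).
Implicit Types (p q d : 'rV[R]_2).

Lemma gam_shift t (k : int) : G (t + (pi + pi) * k%:~R) = G t.
Proof.
have h (n : nat) u : G (u + (pi + pi) * n%:R) = G u.
  elim: n => [|n ih]; first by rewrite mulr0 addr0.
  by rewrite -[n.+1]addn1 natrD mulrDr mulr1 addrA addrA gamD2pi ih.
case: k => n; first exact: h.
by rewrite -(h n.+1); congr G; rewrite NegzE mulrNz -pmulrn; ring.
Qed.

Lemma len_shift s t (k : int) : s <= t ->
  ell (s + (pi + pi) * k%:~R) (t + (pi + pi) * k%:~R) = ell s t.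
Proof.
have h (n : nat) u v : u <= v ->
    ell (u + (pi + pi) * n%:R) (v + (pi + pi) * n%:R) = ell u v.
  move=> uv; elim: n => [|n ih]; first by rewrite mulr0 !addr0.
  rewrite -[n.+1]addn1 natrD.
  have e x : x + (pi + pi) * (n%:R + 1) = x + (pi + pi) * n%:R + pi + pi by ring.
  by rewrite !e !lenDpi ?lerD2r //; lra.
move=> st; case: k => n; first exact: h.
rewrite -(h n.+1) ?lerD2r //; congr ell; rewrite NegzE mulrNz -pmulrn; ring.
Qed.

Lemma exists_shift (a t : R) : exists k : int,
  a - pi < t + (pi + pi) * k%:~R <= a + pi.
Proof.
have p0 := pi_gt0 R.
pose k := Num.floor ((a + pi - t) / (pi + pi)); exists k.
have := floor_itv ((a + pi - t) / (pi + pi)); rewrite -/k => /andP[h1 h2].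
move: h1; rewrite ler_pdivlMr; last lra.
move: h2; rewrite ltr_pdivrMr; last lra.
by rewrite intrD1 => h1 h2; apply/andP; split; lra.
Qed.

Lemma arc_of_shift d s t (k : int) : arc_of S d s t ->
  arc_of S d (s + (pi + pi) * k%:~R) (t + (pi + pi) * k%:~R).
Proof.
move=> [h1 h2 h3]; split; rewrite ?lerD2r //; first lra.
by rewrite /chord !gam_shift.
Qed.

(** If [f] is not before [a0], the first arc lies in the second. Otherwise a common part, if any, is
    removed from both, and [len_le_equal_chord] compares the rest. *)
Lemma len_le_same_chord f th a0 a1 : f <= th -> th <= f + pi ->
  a0 <= a1 -> a1 <= a0 + pi -> chord f th = chord a0 a1 ->
  a0 - pi < th -> th < a1 -> (ell f th <= ell a0 a1)%E.
Proof.
rewrite le_eqVlt => /predU1P[<- *|hf]; first by rewrite len_xx len_ge0.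
move=> h1 h2 h3 e h4 h5.
have [fa|af] := ltP f a0; last by apply: len_mono => //; lra.
have [ha|ha] := leP a1 (f + pi).
  have [ta|at_] := leP th a0; first by apply: len_le_equal_chord => //; lra.
  have e' : chord f a0 = chord th a1.
    by apply: (addIr (chord a0 th)); rewrite chordD e addrC chordD.
  rewrite (@len_add _ S f a0 th); last lra.
  rewrite (@len_add _ S a0 th a1); last lra.
  rewrite addeC leeD2l //; apply: (len_le_equal_chord _ _ _ _ e'); lra.
(* Left is [f < a0] with [f + pi < a1]. The signs of the cross products with [G f], or with
   [G (a0 - pi)] if [f + pi < a0], exclude this. *)
exfalso; have c1 : 0 <= c f th by apply: cross_gam_ge0; lra.
have [a0f|fa0] := leP a0 (f + pi).
  have c0 : 0 <= c f a0 by apply: cross_gam_ge0; lra.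
  have : c f (a1 - pi) = - c f th - c f a0.
    have := congr1 (cross (G f)) e; rewrite /chord !crossE gamBpi !crossE; lra.
  have [a1f|a1f] := ltP (a1 - pi) (f + pi).
    have : 0 < c f (a1 - pi) by apply: cross_gam_gt0; lra.
    lra.
  (* The extreme position gives [G th = 3 *: G f], of norm 3. *)
  move=> _; have ea0 : a0 = f + pi by lra.
  have ea1 : a1 = f + pi + pi by lra.
  move: e; rewrite /chord ea0 ea1 gamD2pi gamDpi => e.
  have e3 : G th = 3 *: G f by rewrite -(subrK (G f) (G th)) e; vec.
  have := gam1 S th; rewrite e3.
  rewrite nrmZp // gam1; lra.
have := congr1 (cross (G (a0 - pi))) e; rewrite /chord !crossE.
have p1 : 0 < c f (a0 - pi) by apply: cross_gam_gt0; lra.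
have p2 : 0 <= c (a0 - pi) th by apply: cross_gam_ge0; lra.
have p3 : 0 <= c (a0 - pi) (a1 - pi) by apply: cross_gam_ge0; lra.
move: p3; rewrite [G (a1 - pi)]gamBpi crossNr.
move: p1; rewrite (crossC _ (G (a0 - pi)) (G f)).
rewrite -[G a0]opprK -gamBpi crossNr crosspp; lra.
Qed.

End Representatives.

Section Mirror.
Context {R : realType} (S : circle R).

(** The same circle run through backwards. It turns statements about the starts of arcs into
    statements about their ends, and the chord [d] into [- d]. *)
Definition mirror : circle R.
Proof.
refine (@Circle R (nrm S) (- ori S) (fun t => gam S (- t))
  (fun s t => len S (- t) (- s)) (@nrmD _ S) (@nrmZ _ S) (@nrm_eq0 _ S)
  (@nrm_continuous _ S) (fun t => gam1 S (- t)) _ _ _ _ _ _ _ _).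
- by move=> p /(gam_onto (c := S))[t ->]; exists (- t); rewrite opprK.
- by move=> t; apply: continuous_comp; [exact: oppr_continuous|exact: gam_continuous].
- by move=> t; rewrite opprD gamBpi.
- move=> s t /andP[h1 h2].
  have : 0 < ori S * det (gam S (- t)) (gam S (- s)) by apply: gam_ori; lra.
  by rewrite /det; lra.
- by move=> s r t h; rewrite addeC -len_add //; lra.
- by move=> s t h; rewrite -nrmBC; apply: len_ge; lra.
- move=> s t h; have h' : - (t + pi) <= - (s + pi) by lra.
  by rewrite -(lenDpi S h'); congr len; ring.
- move=> s t F h hF.
  rewrite (_ : F t - F s = - F (- - s) - - F (- - t)); last by rewrite !opprK; ring.
  apply: (len_le (F := fun x => - F (- x))); first lra.
  move=> r r' h1 h2 h3; rewrite nrmBC -[r]opprK -[r']opprK.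
  by apply: le_trans (hF (- r') (- r) _ _ _) _; rewrite ?opprK; lra.
Defined.

End Mirror.

Section MirrorArcs.
Context {R : realType} (S : circle R).

Lemma arc_of_mirror d s t :
  arc_of S d s t -> arc_of (mirror S) (- d) (- t) (- s).
Proof.
move=> [h1 h2 <-]; split; [lra|lra|rewrite /chord /= !opprK; vec].
Qed.

Lemma arc_of_mirrorK d s t :
  arc_of (mirror S) (- d) s t -> arc_of S d (- t) (- s).
Proof.
by move=> [h1 h2 h3]; split; [lra|lra|rewrite -[d]opprK -h3 /chord /=; vec].
Qed.

Lemma arc_out_mirror r0 r1 r2 : r0 <= r1 -> r1 <= r2 -> r2 <= r0 + pi ->
  1 <= nrm S (gam S r2 + gam S r1 - gam S r0).
Proof.
move=> h1 h2 h3; have := @arc_out _ (mirror S) (- r2) (- r1) (- r0).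
by rewrite /= !opprK; apply; lra.
Qed.

Lemma len_le_same_chord_mirror s t a0 a1 : s <= t -> t <= s + pi ->
  a0 <= a1 -> a1 <= a0 + pi -> chord S s t = chord S a0 a1 ->
  a0 < s -> s < a1 + pi -> (len S s t <= len S a0 a1)%E.
Proof.
move=> h1 h2 h3 h4 e h5 h6.
have e' : chord (mirror S) (- t) (- s) = chord (mirror S) (- a1) (- a0).
  by apply: oppr_inj; rewrite /chord /= !opprK !opprB.
have := @len_le_same_chord _ (mirror S) (- t) (- s) (- a1) (- a0).
rewrite /= !opprK => H; apply: (H _ _ _ _ e'); lra.
Qed.

End MirrorArcs.

Section Tops.
Context {R : realType} (S : circle R).
Local Notation N := (nrm S).
Local Notation G := (gam S).
Local Notation ell := (len S).
Local Notation cross := (cross S).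
Local Notation chord := (chord S).
Implicit Types (p q d : 'rV[R]_2).

Lemma exists_shift_lt (a t : R) : exists k : int,
  a - pi <= t + (pi + pi) * k%:~R < a + pi.
Proof.
have [k /andP[h1 h2]] := exists_shift (- a) (- t).
by exists (- k); rewrite mulrNz; lra.
Qed.

Lemma gam_onto_near (a : R) p : N p = 1 ->
  exists t, [/\ a - pi < t, t <= a + pi & p = G t].
Proof.
move=> /gam_onto[t ->]; have [k /andP[h1 h2]] := exists_shift a t.
by exists (t + (pi + pi) * k%:~R); rewrite gam_shift.
Qed.

(* If [q := G th] and [q - d] both lie in the unit ball, then the chord [d] can
   be placed on the half of the circle that ends at [q]. *)
Lemma arc_before d a0 a1 th : arc_of S d a0 a1 -> N (G th - d) <= 1 ->
  exists s t, [/\ arc_of S d s t, (ell s t <= ell a0 a1)%E, t <= th & th <= s + pi].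
Proof.
move=> hA; have [k /andP[]] := exists_shift_lt th a0.
rewrite -(@len_shift _ S a0 a1 k); last by case: hA.
move: (arc_of_shift k hA) => {hA}.
move: (_ + _) => {}a0; move: (_ + _) => {}a1 hA k1 k2 hN.
have [h1 h2 h3] := hA.
have [ath|tha] := leP a1 th; first by exists a0, a1; split=> //; lra.
(* Since [a1] lies after [th], [arc_out] keeps [G th - d] out of the open ball in every position. *)
have N1 : N (G th - d) = 1.
  apply/le_anti; rewrite hN /= -h3 /chord.
  have [c1|c1] := leP a0 th.
    rewrite (_ : _ - _ = G a0 + G th - G a1); last by vec.
    by apply: arc_out => //; lra.
  have [c2|c2] := leP a1 (th + pi).
    rewrite (_ : _ - _ = G th + G a0 - G a1); last by vec.
    by apply: arc_out => //; lra.
  rewrite -nrmN (_ : - _ = G a1 + G (th + pi) - G a0); last by rewrite gamDpi; vec.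
  by apply: arc_out_mirror; lra.
have [f [f1 f2 ef]] := gam_onto_near th N1.
have [fth|thf] := leP f th.
  have e : chord f th = d by rewrite /chord -ef; vec.
  exists f, th; split; [split=> //; lra| |exact: lexx|lra].
  by apply: len_le_same_chord; rewrite ?e //; lra.
(* If [G f] comes after [G th], their antipodes, in the opposite roles, have chord [d]. *)
have e : chord (th - pi) (f - pi) = d by rewrite /chord !gamBpi -ef; vec.
exists (th - pi), (f - pi); split; [split=> //; lra| |lra|lra].
have e' : chord (th - pi + (pi + pi)) (f - pi + (pi + pi)) = d.
  by rewrite -e /chord; congr (_ - _); rewrite addrA gamD2pi.
rewrite -(@len_shift _ S (th - pi) (f - pi) 1) ?lerD2r ?(ltW thf) // mulr1.
by apply: len_le_same_chord_mirror; rewrite ?e' ?h3 //; lra.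
Qed.

End Tops.

(** * Placing a chord inside a given arc *)

Section Lens.
Context {R : realType} (S : circle R).
Local Notation N := (nrm S).
Local Notation G := (gam S).
Local Notation cross := (cross S).
Local Notation chord := (chord S).
Implicit Types (p q d : 'rV[R]_2).

(** The intermediate value theorem for [N (G s + d)] finds [s] with [G s + d] on the circle: the
    value at [h1] is at least 1 because [G h1 + d] and [G h1 - d] add up to [2 *: G h1]. A parameter
    of [G s + d] outside of the arc would contradict [arc_out]. *)
Lemma subarc_strict h0 h1 d : h0 <= h1 -> h1 <= h0 + pi ->
  N (G h0 + d) < 1 -> N (G h1 - d) < 1 ->
  exists s t, [/\ h0 <= s, s <= t, t <= h1 & chord s t = d].
Proof.
move=> h01 h10 n0 n1.
pose f s := N (G s + d).
have cf : continuous f.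
  move=> x; apply: (@continuous_comp _ _ _ (fun s => G s + d) N).
    by apply: cvgD; [exact: gam_continuous|exact: cvg_cst].
  exact: nrm_continuous.
have f1 : 1 <= f h1.
  have := nrmD S (G h1 + d) (G h1 - d).
  rewrite (_ : _ + _ = 2 *: G h1); last by vec.
  by rewrite nrmZp // gam1 /f; lra.
have [|s] := @IVT _ f h0 h1 1 h01 (continuous_subspaceT cf).
  by rewrite ge_min le_max f1 (ltW n0) orbT.
rewrite in_itv /= => /andP[s0 s1] /(gam_onto_near s)[t [t1 t2 e]].
have et : chord s t = d by rewrite /chord -e; vec.
have [st|ts] := leP s t.
  have [th|ht] := leP t h1; first by exists s, t.
  have : 1 <= N (G s + G h1 - G t) by apply: arc_out; lra.
  rewrite (_ : _ - _ = G h1 - d); last by rewrite -et /chord; vec.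
  by rewrite leNgt n1.
have [th|ht] := leP t h0.
  have : 1 <= N (G t + G h0 - G s) by apply: arc_out; lra.
  rewrite (_ : _ - _ = G h0 + d); last by rewrite -et /chord; vec.
  by rewrite leNgt n0.
have : 1 <= N (G h1 + G s - G t) by apply: arc_out_mirror; lra.
rewrite (_ : _ - _ = G h1 - d); last by rewrite -et /chord; vec.
by rewrite leNgt n1.
Qed.

(** The set is a continuous image of a square: [t] is written as [s + l * (h1 - s)] with [l] between
    0 and 1. *)
Lemma subarc_chords_closed h0 h1 : h0 <= h1 -> closed
  [set d | exists s t, [/\ h0 <= s, s <= t, t <= h1 & chord s t = d]].
Proof.
move=> h01.
pose psi (x : R * R) := G (x.1 + x.2 * (h1 - x.1)) - G x.1.
rewrite (_ : [set _ | _] = psi @` (`[h0, h1] `*` `[0, 1])).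
  apply: compact_closed; first exact: norm_hausdorff.
  apply: continuous_compact; last by apply: compact_setX; exact: segment_compact.
  apply: continuous_subspaceT => x; apply: cvgB.
    apply: (@continuous_comp _ _ _ (fun x : R * R => x.1 + x.2 * (h1 - x.1)) G);
      last exact: gam_continuous.
    apply: cvgD; first exact: cvg_fst.
    apply: cvgM; first exact: cvg_snd.
    by apply: cvgB; [exact: cvg_cst|exact: cvg_fst].
  apply: (@continuous_comp _ _ _ fst G); first exact: cvg_fst.
  exact: gam_continuous.
apply/seteqP; split => d.
  move=> [s [t [hs st th <-]]].
  have [sh|] := ltP s h1.
    exists (s, (t - s) / (h1 - s)).
      rewrite /= !in_itv /= hs (le_trans st th) /=; split=> //.
      rewrite divr_ge0 ?subr_ge0 ?(ltW sh) //=.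
      by rewrite ler_pdivrMr ?subr_gt0 // mul1r lerD2r.
    rewrite /psi /= divfK ?subr_eq0 ?gt_eqF //.
    by rewrite (_ : s + (t - s) = t) //; ring.
  move=> hs1; have -> : s = h1 by lra.
  have -> : t = h1 by lra.
  exists (h1, 0); last by rewrite /psi /= mul0r addr0.
  by split; rewrite /= in_itv /= ?h01 lexx ?ler01.
move=> [[s l]]; rewrite /= !in_itv /= => -[/andP[s0 s1] /andP[l0 l1]] <-.
exists s, (s + l * (h1 - s)); split => //; last by rewrite -subr_ge0; nra.
by rewrite lerDl mulr_ge0 ?subr_ge0.
Qed.

(** The chord [d] is the limit of chords moved towards [2^-1 *: chord h0 h1]. This mixes the points
    [G h0 + d] and [G h1 - d] with the midpoint of [G h0] and [G h1], which is interior, so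
    [subarc_strict] applies to them. *)
Lemma subarc h0 h1 d : h0 <= h1 -> h1 <= h0 + pi ->
  N (G h0 + d) <= 1 -> N (G h1 - d) <= 1 -> N (G h0 + G h1) < 2 ->
  exists s t, [/\ h0 <= s, s <= t, t <= h1 & chord s t = d].
Proof.
move=> h01 h10 n0 n1 n2.
pose m := 2^-1 *: chord h0 h1 - d.
pose u n := d + (harmonic n : R) *: m.
have hu : u @ \oo --> d.
  rewrite (_ : nbhs d = nbhs (d + 0 *: m)); last by rewrite scale0r addr0.
  apply: cvgD; first exact: cvg_cst.
  by apply: cvgZl; exact: cvg_harmonic.
have cl := subarc_chords_closed h01.
apply: (@closed_cvg _ _ \oo _ u _ cl _ _ hu); apply: nearW => n /=.
have : 0 < (harmonic n : R) <= 1.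
  by rewrite /harmonic /= invr_gt0 ltr0Sn /= invf_le1 ?ltr0Sn // ler1n.
rewrite /u; move: (harmonic n) => e /andP[e0 e1].
have key p : N p <= 1 -> N ((1 - e) *: p + e *: (2^-1 *: (G h0 + G h1))) < 1.
  move=> np; apply: le_lt_trans (nrmD _ _ _) _.
  rewrite !nrmZp; try lra.
  have : e * (2^-1 * N (G h0 + G h1)) < e * 1 by rewrite ltr_pM2l; lra.
  have : (1 - e) * N p <= (1 - e) * 1 by rewrite ler_wpM2l //; lra.
  lra.
apply: subarc_strict => //.
  rewrite (_ : _ + _ = (1 - e) *: (G h0 + d) + e *: (2^-1 *: (G h0 + G h1))).
    exact: key.
  by rewrite /m /chord; apply/rowP => i; rewrite !mxE; field.
rewrite (_ : _ - _ = (1 - e) *: (G h1 - d) + e *: (2^-1 *: (G h0 + G h1))).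
  exact: key.
by rewrite /m /chord; apply/rowP => i; rewrite !mxE; field.
Qed.

Lemma exists_arc_of d : N d <= 2 -> exists s t, arc_of S d s t.
Proof.
move=> d2; have p0 := pi_gt0 R.
have [->|d0] := eqVneq d 0.
  by exists 0, 0; split; [|lra|rewrite chordxx].
have nd : 0 < N d.
  rewrite lt0r nrm_ge0 andbT; apply/eqP => /nrm_eq0 /eqP; exact/negP.
(* On the half circle from [- d / N d] to [d / N d], the vector [G h0 + d] has norm [|N d - 1|]. *)
have [|h0 eh] := @gam_onto _ S (- (N d)^-1 *: d).
  by rewrite nrmZ normrN gtr0_norm ?invr_gt0 // mulVf ?gt_eqF.
have e : G h0 + d = (1 - (N d)^-1) *: d by rewrite -eh; vec.
have n0 : N (G h0 + d) <= 1.
  rewrite e nrmZ -{2}(gtr0_norm nd) -normrM mulrBl mulVf ?gt_eqF // mul1r.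
  by rewrite ler_norml; lra.
have n1 : N (G (h0 + pi) - d) <= 1 by rewrite gamDpi -nrmN opprB opprK addrC.
have n2 : N (G h0 + G (h0 + pi)) < 2 by rewrite gamDpi subrr nrm0.
have hp : h0 <= h0 + pi by lra.
have [s [t [h1 h2 h3 h4]]] := subarc hp (lexx _) n0 n1 n2.
by exists s, t; split => //; lra.
Qed.

End Lens.

(** * Arcs for the sum of two chords *)

Section Sums.
Context {R : realType} (S : circle R).
Local Notation N := (nrm S).
Local Notation G := (gam S).
Local Notation ell := (len S).
Local Notation cross := (cross S).
Local Notation chord := (chord S).
Local Notation c s t := (cross (G s) (G t)).
Implicit Types (p q d u v : 'rV[R]_2).

(** The line through [u] and [v] supports the ball. If [al + be] exceeded 1, then [u + v] would be a
    combination of [u], [v] and the given point with coefficient sum below 2; a small [z] keeps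
    these coefficients nonnegative. *)
Lemma flat_cone u v (al be : R) : N u = 1 -> N v = 1 -> N (u + v) = 2 ->
  N (al *: u + be *: v) <= 1 -> al + be <= 1.
Proof.
move=> u1 v1 uv2 p1; rewrite leNgt; apply/negP => s1.
pose z := (1 + `|al| + `|be|)^-1.
have a0 := normr_ge0 al; have b0 := normr_ge0 be.
have D0 : 0 < 1 + `|al| + `|be| by lra.
have z0 : 0 < z by rewrite invr_gt0.
have zal : z * al <= 1.
  by rewrite mulrC ler_pdivrMr // mul1r; have := ler_norm al; lra.
have zbe : z * be <= 1.
  by rewrite mulrC ler_pdivrMr // mul1r; have := ler_norm be; lra.
have : N (u + v) <= (1 - z * al) + (1 - z * be) + z * N (al *: u + be *: v).
  rewrite (_ : u + v = (1 - z * al) *: u + (1 - z * be) *: v +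
    z *: (al *: u + be *: v)); last by vec.
  rewrite (le_trans (nrmD _ _ _)) // lerD //; last by rewrite nrmZp // ltW.
  rewrite (le_trans (nrmD _ _ _)) // !nrmZp ?subr_ge0 // u1 v1; lra.
rewrite uv2; have : z * N (al *: u + be *: v) <= z * 1 by rewrite ler_pM2l.
have : 0 < z * (al + be - 1) by rewrite mulr_gt0 ?subr_gt0.
lra.
Qed.

(** Converse of [arc_cone]: the signs of the cross products with the ends locate the parameter. *)
Lemma cone_param h0 h1 (al be : R) : h0 < h1 -> h1 < h0 + pi -> 0 <= al ->
  0 <= be -> N (al *: G h0 + be *: G h1) = 1 ->
  exists r, [/\ h0 <= r, r <= h1 & G r = al *: G h0 + be *: G h1].
Proof.
move=> h01 h10 a0 b0 /(gam_onto_near h0)[r [r1 r2 e]].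
have k := cross_gam_gt0 S h01 h10.
have e1 : c h0 r = be * c h0 h1 by rewrite -e !crossE; ring.
have e2 : c r h1 = al * c h0 h1 by rewrite -e !crossE; ring.
have hr : h0 <= r.
  rewrite leNgt; apply/negP => rh.
  have : 0 < c r h0 by apply: cross_gam_gt0; lra.
  by rewrite crossC e1 oppr_gt0 ltNge mulr_ge0 // ltW.
exists r; split => //; rewrite leNgt; apply/negP => hr1.
have : 0 < c h1 r by apply: cross_gam_gt0; lra.
by rewrite crossC e2 oppr_gt0 ltNge mulr_ge0 // ltW.
Qed.

(* Equality in [N (u + v) <= 2] means that the arc from [u] to [v] is a segment.
   Chords of segments can be shifted, so this case escapes [subarc]. *)
Section FlatArc.
Variables h0 h1 : R.
Hypotheses (h01 : h0 < h1) (h10 : h1 < h0 + pi).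
Hypothesis flat : N (G h0 + G h1) = 2.

(** [triple_ineq] and [flat_cone] together give [al + be = 1]. *)
Lemma flat_point r : h0 <= r -> r <= h1 ->
  exists be, [/\ 0 <= be, be <= 1, c h0 r = be * c h0 h1 &
    G r = G h0 + be *: chord h0 h1].
Proof.
move=> r0 r1.
have [al [be [a0 b0 e _ e2]]] := arc_cone S r0 r1 h01 h10.
have [i1 i2 i3] : [/\ 1 <= al + be, al <= 1 + be & be <= 1 + al].
  by apply: (triple_ineq (gam1 S h0) (gam1 S h1)) => //; rewrite -e gam1.
have : al + be <= 1.
  by apply: (flat_cone (gam1 S h0) (gam1 S h1)) => //; rewrite -e gam1.
move=> i4; exists be; split => //; first lra.
by rewrite e (_ : al = 1 - be) /chord; [vec|lra].
Qed.

Lemma flat_chord r r' : h0 <= r -> r <= r' -> r' <= h1 ->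
  exists k, [/\ 0 <= k, k <= 1 & chord r r' = k *: chord h0 h1].
Proof.
move=> k1 k2 k3.
have [b [b0 b1 eb e]] := flat_point k1 (le_trans k2 k3).
have [b' [b0' b1' eb' e']] := flat_point (le_trans k1 k2) k3.
have lt_h10 := h10.
exists (b' - b); split; [|lra|by rewrite [in LHS]/chord e e'; vec].
have : 0 <= c r r' by apply: cross_gam_ge0; lra.
rewrite e' crossDr crossZr [cross (G r) (G h0)]crossC eb.
rewrite e crossDl crossZl crosspp mulr0 addr0 {1}/chord crossDr crossNr crosspp subr0.
have k0 := cross_gam_gt0 S h01 h10.
by rewrite -mulNr -mulrDl pmulr_lge0 // addrC.
Qed.

Lemma len_flat r : h0 <= r -> r <= h1 -> (ell h0 r <= (N (chord h0 r))%:E)%E.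
Proof.
have lt_h10 := h10; move=> r0 r1; apply: len_collinear => //; first lra.
move=> x y x1 x2 x3.
have [k [_ _ ->]] := flat_chord (lexx _) r0 r1.
have [k' [_ _ ->]] := flat_chord x1 x2 (le_trans x3 r1).
by rewrite crossZl crossZr crosspp !mulr0.
Qed.

Lemma flat_onto k : 0 <= k -> k <= 1 ->
  exists r, [/\ h0 <= r, r <= h1 & chord h0 r = k *: chord h0 h1].
Proof.
move=> k0 k1.
have e x : G h0 + x *: chord h0 h1 = (1 - x) *: G h0 + x *: G h1 by rewrite /chord; vec.
have le1 x : 0 <= x -> x <= 1 -> N ((1 - x) *: G h0 + x *: G h1) <= 1.
  move=> x0 x1; rewrite (le_trans (nrmD _ _ _)) // !nrmZp ?gam1 ?subr_ge0 //; lra.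
have k1' : 0 <= 1 - k by lra.
(* The points at fractions [k] and [1 - k] add up to [G h0 + G h1], of norm 2, and neither norm
   exceeds 1. *)
have e1 : N ((1 - k) *: G h0 + k *: G h1) = 1.
  apply/le_anti; rewrite le1 //=.
  have := nrmD S ((1 - k) *: G h0 + k *: G h1) ((1 - (1 - k)) *: G h0 + (1 - k) *: G h1).
  rewrite (_ : _ + _ = G h0 + G h1); last by vec.
  have : N ((1 - (1 - k)) *: G h0 + (1 - k) *: G h1) <= 1 by apply: le1; lra.
  by rewrite flat; lra.
have [r [r0 r1 er]] := cone_param h01 h10 k1' k0 e1.
by exists r; split => //; rewrite /chord er; vec.
Qed.

End FlatArc.

(** By [arc_in] at both ends, [subarc] places the sum inside the arc from [a0] to [b1], and
    [len_le_gap] bounds its length. In the flat case the fractions of the segment are added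
    instead. *)
Lemma exists_sum_arc_half a0 a1 b0 b1 :
  a0 <= a1 -> a1 <= b0 -> b0 <= b1 -> b1 <= a0 + pi ->
  exists s t, arc_of S (chord a0 a1 + chord b0 b1) s t /\
    (ell s t <= ell a0 a1 + ell b0 b1)%E.
Proof.
move=> h1 h2 h3 h4; have hH : a0 <= b1 by lra.
have n0 : N (G a0 + (chord a0 a1 + chord b0 b1)) <= 1.
  rewrite (_ : _ + _ = G a1 - G b0 + G b1); last by rewrite /chord; vec.
  by apply: arc_in; lra.
have n1 : N (G b1 - (chord a0 a1 + chord b0 b1)) <= 1.
  rewrite (_ : _ - _ = G a0 - G a1 + G b0); last by rewrite /chord; vec.
  by apply: arc_in; lra.
have n2 : N (G a0 + G b1) <= 2.
  by have := nrmD S (G a0) (G b1); rewrite !gam1; lra.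
move: n2; rewrite le_eqVlt => /predU1P[n2|n2]; last first.
  have [s [t [s0 st t1 e]]] := subarc hH h4 n0 n1 n2.
  exists s, t; split; first by split => //; lra.
  exact: len_le_gap.
have [hH'|] := ltP a0 b1; last first.
  move=> b1a0; exists a0, a0; split.
    split => //; first by have := pi_ge0 R; lra.
    have -> : a1 = a0 by lra.
    have -> : b0 = a0 by lra.
    by have -> : b1 = a0 by [lra]; rewrite !chordxx addr0.
  by rewrite len_xx adde_ge0 // len_ge0.
move: h4; rewrite le_eqVlt => /predU1P[h4|h4].
  by move: n2; rewrite h4 gamDpi subrr nrm0; lra.
have [k [k0 k1 ek]] := flat_chord hH' h4 n2 (lexx a0) h1 (le_trans h2 h3).
have [k' [k0' k1' ek']] := flat_chord hH' h4 n2 (le_trans h1 h2) h3 (lexx b1).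
have [k'' [k0'' k1'' ek'']] := flat_chord hH' h4 n2 h1 h2 h3.
have ks : k + k' + k'' = 1.
  apply/eqP; rewrite -subr_eq0; apply/eqP.
  have hz : (k + k' + k'' - 1) *: chord a0 b1 = 0.
    rewrite -[RHS](subrr (chord a0 b1)) -{2}(chordD S a0 a1 b1) -(chordD S a1 b0 b1).
    by rewrite ek ek' ek''; vec.
  have : chord a0 b1 != 0 by apply: chord_neq0; lra.
  by move/eqP: hz; rewrite scaler_eq0 => /orP[/eqP|/eqP ->]; rewrite ?eqxx.
have kk0 : 0 <= k + k' by lra.
have kk1 : k + k' <= 1 by lra.
have [r [r0 r1 er]] := flat_onto hH' h4 n2 kk0 kk1.
have e : chord a0 r = chord a0 a1 + chord b0 b1 by rewrite er ek ek'; vec.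
exists a0, r; split; first by split => //; lra.
rewrite (le_trans (len_flat hH' h4 n2 r0 r1)) // e.
rewrite (@le_trans _ _ (N (chord a0 a1) + N (chord b0 b1))%:E) ?lee_fin ?nrmD //.
by rewrite EFinD leeD // chord_le.
Qed.

(** When the arcs do not fit into a half circle, a part of one is antipodal to a part of the other.
    The chords of these parts cancel, and what remains fits into a half circle. *)
Lemma exists_sum_arc d1 d2 a0 a1 b0 b1 :
  arc_of S d1 a0 a1 -> arc_of S d2 b0 b1 -> a1 <= b0 -> b1 <= a0 + pi + pi ->
  exists s t, arc_of S (d1 + d2) s t /\ (ell s t <= ell a0 a1 + ell b0 b1)%E.
Proof.
(* If the gap from [a1] to [b0] exceeds [pi], a full turn of the first arc swaps the roles. *)
wlog gap : d1 d2 a0 a1 b0 b1 / b0 <= a1 + pi => [th|].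
  have [gap|gap] := leP b0 (a1 + pi); first exact: th.
  move=> hA hB h1 h2; have := hA => -[a01 a10 _]; have := hB => -[b01 b10 _].
  have := arc_of_shift 1 hA; rewrite mulr1 => hA'.
  rewrite -(@len_shift _ S a0 a1 1) // mulr1 addeC addrC.
  by apply: th; [|exact: hB|exact: hA'| |]; lra.
move=> [a01 a10 <-] [b01 b10 <-] ab ba.
have [h|h] := leP b1 (a0 + pi); first exact: exists_sum_arc_half.
have go x0 x1 y0 y1 : x0 <= x1 -> x1 <= y0 -> y0 <= y1 -> y1 <= x0 + pi ->
    chord x0 x1 + chord y0 y1 = chord a0 a1 + chord b0 b1 ->
    (ell x0 x1 + ell y0 y1 <= ell a0 a1 + ell b0 b1)%E ->
    exists s t, arc_of S (chord a0 a1 + chord b0 b1) s t /\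
      (ell s t <= ell a0 a1 + ell b0 b1)%E.
  move=> g1 g2 g3 g4 <- g5.
  have [s [t [g6 g7]]] := exists_sum_arc_half g1 g2 g3 g4.
  by exists s, t; split => //; apply: le_trans g7 g5.
have gpp x : G (x - pi - pi) = G x by rewrite !gamBpi opprK.
(* Four positions of the second arc, turned back by [pi], relative to the first one; the overlap is
   removed from both. *)
have [c1|c1] := leP (b1 - pi) a1; have [c2|c2] := leP b0 (a0 + pi).
- have e : chord (b1 - pi) a1 + chord b0 (a0 + pi) = chord a0 a1 + chord b0 b1.
    by rewrite /chord gamBpi gamDpi; vec.
  apply: (go _ _ _ _ _ _ _ _ e); [lra|lra|lra|lra|].
  by apply: leeD; apply: len_mono; lra.
- have e : chord a0 (b0 - pi) + chord (b1 - pi) a1 = chord a0 a1 + chord b0 b1.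
    by rewrite /chord !gamBpi; vec.
  apply: (go _ _ _ _ _ _ _ _ e); [lra|lra|lra|lra|].
  rewrite (le_trans _ (leeDl _ (len_ge0 _ b01))) //.
  rewrite (@len_add _ S a0 (b1 - pi) a1) ?leeD2r //; last lra.
  by apply: len_mono; lra.
- have e : chord b0 (a0 + pi) + chord (a1 + pi) b1 = chord a0 a1 + chord b0 b1.
    by rewrite /chord !gamDpi; vec.
  apply: (go _ _ _ _ _ _ _ _ e); [lra|lra|lra|lra|].
  rewrite (le_trans _ (leeDr _ (len_ge0 _ a01))) //.
  rewrite (@len_add _ S b0 (a1 + pi) b1) ?leeD2r //; last lra.
  by apply: len_mono; lra.
- have e : chord (a1 - pi) (b1 - pi - pi) + chord a0 (b0 - pi) = chord a0 a1 + chord b0 b1.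
    by rewrite /chord gpp !gamBpi; vec.
  apply: (go _ _ _ _ _ _ _ _ e); [lra|lra|lra|lra|].
  rewrite addeC; apply: leeD; first by apply: len_mono; lra.
  rewrite -lenDpi ?subrK; last lra.
  rewrite -lenDpi ?subrK; last lra.
  by apply: len_mono; lra.
Qed.

(** Moving the start of a half circle drops an arc and adds its antipode, which is equally long. *)
Lemma len_half s t : ell s (s + pi) = ell t (t + pi).
Proof.
have p0 := pi_ge0 R.
have h x y : x <= y -> y <= x + pi -> ell x (x + pi) = ell y (y + pi).
  move=> xy yx; rewrite (@len_add _ S x y (x + pi)) ?xy //.
  rewrite (@len_add _ S y (x + pi) (y + pi)) ?yx ?lerD2r //.
  by rewrite lenDpi // addeC.
have [k /andP[k1 k2]] := exists_shift s t.
rewrite -(@len_shift _ S t (t + pi) k) ?lerDl //.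
rewrite (_ : t + pi + _ = t + (pi + pi) * k%:~R + pi); last by ring.
by have [st|ts] := leP s (t + (pi + pi) * k%:~R); [apply: h|symmetry; apply: h]; lra.
Qed.

End Sums.

Section ThreePoints.
Context {R : realType} (S : circle R).
Local Notation N := (nrm S).
Local Notation G := (gam S).
Local Notation ell := (len S).
Local Notation cross := (cross S).
Local Notation chord := (chord S).
Local Notation c s t := (cross (G s) (G t)).
Implicit Types (p q d u v : 'rV[R]_2).

Lemma bounded_ray0 p d : (forall n : nat, N (p + n%:R *: d) <= 1) -> d = 0.
Proof.
move=> h; apply: (nrm_eq0 (c := S)); apply/eqP; rewrite eq_le nrm_ge0 andbT leNgt.
apply/negP => d0.
have /archi_boundP : 0 <= 2 / N d by rewrite divr_ge0 // ltW.
set n := Num.bound _; rewrite ltr_pdivrMr // => hn.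
have := h n; have := h 0%N; rewrite scale0r addr0 => h0 hn'.
have := nrmB S (p + n%:R *: d) p.
rewrite (_ : _ - p = n%:R *: d); last by vec.
rewrite nrmZp //; lra.
Qed.

(* With [d = z - x] and [d1 = y - x]: the translate [v + C] contains [x], [z],
   [y] if and only if [a], [a + d], [a + d1] lie in [C], where [a = x - v]. *)
Definition in_spindle d d1 := forall a, N a <= 1 -> N (a + d) <= 1 -> N (a + d1) <= 1.

(** The reflection of [a] to [- (a + (d1 + d2))] preserves the set of admissible [a]. *)
Lemma in_spindleC d1 d2 : in_spindle (d1 + d2) d1 -> in_spindle (d1 + d2) d2.
Proof.
move=> h a a1 a2; rewrite -nrmN (_ : - _ = - (a + (d1 + d2)) + d1); last by vec.
apply: h; first by rewrite nrmN.
by rewrite (_ : _ + _ = - a) ?nrmN //; vec.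
Qed.

(* For [k < 0] the points [u + n k d] would stay in the unit ball for all [n]. *)
Lemma in_spindle_flat u d k : N u <= 1 -> N (u + d) <= 1 ->
  in_spindle d (k *: d) -> d != 0 -> 0 <= k.
Proof.
move=> u1 ud1 hs; apply: contraNT; rewrite -ltNge => k0.
suff /eqP : k *: d = 0 by rewrite scaler_eq0 lt_eqF.
apply: (@bounded_ray0 u) => n.
elim: n => [|n ih]; first by rewrite scale0r addr0.
rewrite (_ : _ + _ = (u + n%:R *: (k *: d)) + k *: d); last first.
  by rewrite -[n.+1]addn1 natrD; vec.
apply: hs => //.
set x : R := n%:R * k.
have x0 : x <= 0 by rewrite mulr_ge0_le0 // ltW.
have y0 : 0 < 1 - x by lra.
(* Since [x <= 0], the point [u + (x + 1) *: d] lies between [u + x *: d] and [u + d]. *)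
have -> : u + n%:R *: (k *: d) + d =
   (1 - (1 - x)^-1) *: (u + n%:R *: (k *: d)) + (1 - x)^-1 *: (u + d).
  by apply/rowP => i; rewrite !mxE /x; field; rewrite gt_eqF.
have i0 : 0 < (1 - x)^-1 by rewrite invr_gt0.
have i1 : (1 - x)^-1 <= 1 by rewrite invf_le1 //; lra.
rewrite (le_trans (nrmD _ _ _)) // !nrmZp ?subr_ge0 ?(ltW i0) //.
have : (1 - x)^-1 * N (u + d) <= (1 - x)^-1 * 1 by rewrite ler_pM2l.
have : (1 - (1 - x)^-1) * N (u + n%:R *: (k *: d)) <= (1 - (1 - x)^-1) * 1.
  by rewrite ler_wpM2l // subr_ge0.
lra.
Qed.

(** The choice [a = G w0] puts [G w0 + d1] and [G w1 - d1 = G w0 + d2] into the ball, which is what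
    [subarc] needs; [len_superadditive] compares the lengths. On a flat arc the two chords are
    adjacent pieces of one segment. *)
Lemma spindle_arcs d1 d2 w0 w1 : arc_of S (d1 + d2) w0 w1 ->
  in_spindle (d1 + d2) d1 ->
  exists s t s' t', [/\ arc_of S d1 s t, arc_of S d2 s' t' &
    (ell s t + ell s' t' <= ell w0 w1)%E].
Proof.
have p0 := pi_gt0 R.
move=> [w01 w10 e] hs; have hs' := in_spindleC hs.
have n00 : N (G w0 + (d1 + d2)) <= 1 by rewrite -e /chord addrC subrK gam1.
have n1 : N (G w0 + d1) <= 1 by apply: hs; rewrite ?gam1.
have n2 : N (G w0 + d2) <= 1 by apply: hs'; rewrite ?gam1.
have eW : G w1 = G w0 + (d1 + d2) by rewrite -e /chord; vec.
have e1 : G w1 - d1 = G w0 + d2 by rewrite eW; vec.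
have e2 : G w1 - d2 = G w0 + d1 by rewrite eW; vec.
have n3 : N (G w0 + G w1) <= 2.
  by have := nrmD S (G w0) (G w1); rewrite !gam1; lra.
move: n3; rewrite le_eqVlt => /predU1P[n3|n3]; last first.
  have [|s [t [s0 st t1 ed1]]] := subarc w01 w10 n1 _ n3; first by rewrite e1.
  have [|s' [t' [s0' st' t1' ed2]]] := subarc w01 w10 n2 _ n3; first by rewrite e2.
  exists s, t, s', t'; split; [by split => //; lra|by split => //; lra|].
  by apply: len_superadditive => //; rewrite ed1 ed2.
have [d0|dn0] := eqVneq (d1 + d2) 0.
  have z1 : d1 = 0.
    apply: (@bounded_ray0 (G w0)) => n.
    elim: n => [|n ih]; first by rewrite scale0r addr0 gam1.
    rewrite (_ : _ + _ = (G w0 + n%:R *: d1) + d1); last first.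
      by rewrite -[n.+1]addn1 natrD; vec.
    by apply: hs => //; rewrite d0 addr0.
  have z2 : d2 = 0 by move: d0; rewrite z1 add0r.
  exists w0, w0, w0, w0; rewrite z1 z2 len_xx adde0 len_ge0 //.
  by split => //; split; rewrite ?chordxx //; lra.
have w01' : w0 < w1.
  rewrite lt_neqAle w01 andbT; apply: contra_neq dn0 => ww.
  by rewrite -e ww chordxx.
have w10' : w1 < w0 + pi.
  rewrite lt_neqAle w10 andbT; apply/eqP => ww.
  by move: n3; rewrite ww gamDpi subrr nrm0; lra.
have k0 := cross_gam_gt0 S w01' w10'.
have k0' : c w0 w1 != 0 by rewrite gt_eqF.
pose al := cross (G w0 + d1) (G w1) / c w0 w1.
pose be := cross (G w0) (G w0 + d1) / c w0 w1.
have ed1 : G w0 + d1 = al *: G w0 + be *: G w1 by exact: cross_solve.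
have ed2 : G w0 + d2 = (1 - al) *: G w0 + (1 - be) *: G w1.
  rewrite -e1 (_ : _ - _ = G w0 + G w1 - (G w0 + d1)); last by vec.
  by rewrite ed1; vec.
(* Both points lie in the ball and add up to [G w0 + G w1]; [flat_cone] for each forces
   [al + be = 1], so [d1] and [d2] are multiples of [d1 + d2]. *)
have s1 : al + be <= 1.
  by apply: (flat_cone (gam1 S w0) (gam1 S w1) n3); rewrite -ed1.
have s2 : (1 - al) + (1 - be) <= 1.
  by apply: (flat_cone (gam1 S w0) (gam1 S w1) n3); rewrite -ed2.
have f1 : d1 = be *: (d1 + d2).
  rewrite -e (_ : d1 = (G w0 + d1) - G w0); last by vec.
  by rewrite ed1 (_ : al = 1 - be) /chord; [vec|lra].
have f2 : d2 = (1 - be) *: (d1 + d2).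
  by rewrite scalerBl scale1r -f1; vec.
have b0 : 0 <= be.
  by apply: (in_spindle_flat _ n00 _ dn0); rewrite ?gam1 // -f1.
have b1 : 0 <= 1 - be.
  by apply: (in_spindle_flat _ n00 _ dn0); rewrite ?gam1 // -f2.
have [|r [r0 r1 er]] := flat_onto w01' w10' n3 b0; first lra.
have er1 : chord w0 r = d1 by rewrite er e.
have er2 : chord r w1 = d2.
  by apply: (addrI d1); rewrite -{1}er1 chordD e.
exists w0, r, r, w1; split; [by split => //; lra|by split => //; lra|].
by rewrite -len_add // r0.
Qed.

(** The difference is a unit vector minus a point of the ball, by [arc_in]. The contrapositive shows
    that overlapping arcs with [2 < N (d1 - d2)] reach past a half circle. *)
Lemma nrm_sub_overlap d1 d2 a0 a1 b0 b1 : arc_of S d1 a0 a1 -> arc_of S d2 b0 b1 ->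
  a0 <= b0 -> b0 <= a1 -> b1 <= a0 + pi -> N (d1 - d2) <= 2.
Proof.
move=> [a01 a10 <-] [b01 b10 <-] ab ba bp.
rewrite (_ : _ - _ = G a1 - (G a0 - G b0 + G b1)); last by rewrite /chord; vec.
rewrite (le_trans (nrmB _ _ _)) // gam1.
have : N (G a0 - G b0 + G b1) <= 1 by apply: arc_in.
lra.
Qed.

(** The intermediate value theorem on the segment from the center [- (d1 + d2) / 2] of the
    admissible set, where [a + d1] becomes [(d1 - d2) / 2], to the given [a]. *)
Lemma exists_boundary_translate d1 d2 : N (d1 + d2) <= 2 -> N (d1 - d2) <= 2 ->
  (exists a, [/\ N a <= 1, N (a + (d1 + d2)) <= 1 & 1 <= N (a + d1)]) ->
  exists a, [/\ N a <= 1, N (a + (d1 + d2)) <= 1 & N (a + d1) = 1].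
Proof.
move=> h1 h2 [a [a1 a2 a3]].
pose a' := (- 2^-1) *: (d1 + d2).
have a1' : N a' <= 1 by rewrite nrmZ normrN ger0_norm; lra.
have a2' : N (a' + (d1 + d2)) <= 1.
  rewrite (_ : _ + _ = 2^-1 *: (d1 + d2)); first by rewrite nrmZp; lra.
  by rewrite /a'; apply/rowP => i; rewrite !mxE; field.
have a3' : N (a' + d1) <= 1.
  rewrite (_ : _ + _ = 2^-1 *: (d1 - d2)); first by rewrite nrmZp; lra.
  by rewrite /a'; apply/rowP => i; rewrite !mxE; field.
pose g (l : R) := a' + l *: (a - a').
pose f l := N (g l + d1).
have cf : continuous f.
  move=> x; apply: (@continuous_comp _ _ _ (fun l => g l + d1) N).
    apply: cvgD; last exact: cvg_cst.
    apply: cvgD; first exact: cvg_cst.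
    by apply: cvgZl; exact: cvg_id.
  exact: nrm_continuous.
have g0 : g 0 = a' by rewrite /g scale0r addr0.
have g1 : g 1 = a by rewrite /g scale1r addrC subrK.
have conv p l : 0 <= l -> l <= 1 -> N (a' + p) <= 1 -> N (a + p) <= 1 ->
    N (g l + p) <= 1.
  move=> l0 l1 q0 q1.
  rewrite (_ : _ + _ = (1 - l) *: (a' + p) + l *: (a + p)); last by rewrite /g; vec.
  rewrite (le_trans (nrmD _ _ _)) // !nrmZp ?subr_ge0 //.
  have : (1 - l) * N (a' + p) <= (1 - l) * 1 by rewrite ler_wpM2l // subr_ge0.
  have : l * N (a + p) <= l * 1 by rewrite ler_wpM2l.
  lra.
have [|l] := @IVT _ f 0 1 1 ler01 (continuous_subspaceT cf).
  by rewrite /f g0 g1 ge_min le_max a3 a3' orbT.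
rewrite in_itv /= => /andP[l0 l1] fl; exists (g l); split => //.
  by rewrite -[g l]addr0; apply: conv; rewrite ?addr0.
exact: conv.
Qed.

(* If [2 < N (d1 - d2)], then overlapping arcs for [d1] and [d2] cover half of
   the circle, and this is enough to bound the arc for [d1 + d2]. *)
Lemma sum_arcs d1 d2 a0 a1 b0 b1 : N (d1 + d2) <= 2 ->
  (exists a, [/\ N a <= 1, N (a + (d1 + d2)) <= 1 & 1 <= N (a + d1)]) ->
  arc_of S d1 a0 a1 -> arc_of S d2 b0 b1 ->
  exists s t, arc_of S (d1 + d2) s t /\ (ell s t <= ell a0 a1 + ell b0 b1)%E.
Proof.
move=> n1 ha hA hB.
have [n2|n2] := leP (N (d1 - d2)) 2.
  have [a [q1 q2 /gam_onto[th eth]]] := exists_boundary_translate n1 n2 ha.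
  have [|s [t [hA' lA t1 t2]]] := arc_before (th := th) hA.
    by rewrite -eth addrK.
  (* [G th] plays the role of [y]: the arc for [d1] has been placed before it, and the mirror image
     places the one for [d2] after it. *)
  have hBm := arc_of_mirror hB.
  have [|s' [t' [hB' lB t1' t2']]] := arc_before (th := - th) hBm.
    by rewrite /= !opprK -eth -addrA.
  have {}hB' := arc_of_mirrorK hB'.
  have {}lB : (ell (- t') (- s') <= ell b0 b1)%E by move: lB; rewrite /= !opprK.
  have hA0 := hA'; have hB0 := hB'; case: hA0 => A1 A2 _; case: hB0 => B1 B2 _.
  have [||u [v [h1 h2]]] := exists_sum_arc hA' hB'; try lra.
  by exists u, v; split => //; apply: le_trans h2 _; apply: leeD.
have [u [v hW]] := exists_arc_of n1.
(* [e1] and [e2] are [d1] and [d2] in either order, up to sign of the difference. No arc for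
   [d1 + d2] is longer than the half circle that the two arcs cover. *)
have half e1 e2 x0 x1 y0 y1 : arc_of S e1 x0 x1 -> arc_of S e2 y0 y1 ->
    2 < N (e1 - e2) -> x0 <= y0 -> y0 <= x1 -> (ell u v <= ell x0 x1 + ell y0 y1)%E.
  move=> hx hy hn k1 k2; have [k3|/ltW k3] := leP y1 (x0 + pi).
    by move: hn; rewrite ltNge (nrm_sub_overlap hx hy).
  case: hx => X1 X2 _; case: hy => Y1 Y2 _; case: hW => W1 W2 _.
  apply: (@le_trans _ _ (ell u (u + pi))); first exact: len_mono.
  rewrite (len_half S u x0) (@len_add _ S x0 y0 (x0 + pi)); last lra.
  by apply: leeD; apply: len_mono; lra.
(* [b0] is moved into the turn after [a0]. Either the arcs overlap on one side, or they follow each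
   other within one turn. *)
have [k /andP[k1 k2]] := exists_shift (a0 + pi) b0.
move: (arc_of_shift k hB); rewrite -(@len_shift _ S b0 b1 k); last by case: hB.
move: (b0 + _) (b1 + _) k1 k2 => {hB}b0 {}b1 k1 k2 hB.
have hA0 := hA; have hB0 := hB; case: hA0 => A1 A2 _; case: hB0 => B1 B2 _.
have [ab|/ltW ba] := leP a1 b0; last first.
  by exists u, v; split => //; apply: (half _ _ _ _ _ _ hA hB n2); lra.
have [bb|/ltW bb] := leP b1 (a0 + pi + pi).
  exact: exists_sum_arc hA hB ab bb.
exists u, v; split => //; rewrite addeC -(@len_shift _ S a0 a1 1) // mulr1.
have := arc_of_shift 1 hA; rewrite mulr1 => hA'.
by apply: (half _ _ _ _ _ _ hB hA'); rewrite 1?nrmBC //; lra.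
Qed.

End ThreePoints.

(** * The norm of a symmetric convex body *)

Section BodyNorm.
Context {R : realType} (C : set 'rV[R]_2).
Context (C_body : plane_convex_body C) (C_sym : o_symmetric C).
Local Notation N := (Cnorm C).
Implicit Types (p q d u v : 'rV[R]_2) (t k : R).

Lemma body_conv p q k : C p -> C q -> 0 <= k -> k <= 1 ->
  C (k *: p + (1 - k) *: q).
Proof.
case: C_body => _ cC _ Cp Cq k0 k1.
have := cC p q (Itv01 k0 k1); rewrite !inE; exact.
Qed.

Lemma body_opp p : C p -> C (- p).
Proof. by move=> Cp; rewrite C_sym; exists p. Qed.

(** For [x] interior to [C], a small [p] is the midpoint of [x + 2 *: p] and [- x]. *)
Lemma body_ball : exists2 r : R, 0 < r & forall p, `|p| < r -> C p.
Proof.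
case: C_body => _ _ [x]; rewrite /interior /= => /nbhs_ballP[r /= r0 hr].
have r20 : 0 < r / 2 by rewrite divr_gt0.
exists (r / 2) => // p pr.
have h1 : C (x + 2 *: p).
  apply: hr; rewrite -ball_normE /= opprD addrA subrr add0r normrN normrZ.
  by rewrite ger0_norm //; lra.
have h2 : C (- x) by apply: body_opp; apply: hr; exact: ballxx.
have i0 : 0 <= 2^-1 :> R by rewrite invr_ge0.
have i1 : 2^-1 <= 1 :> R by lra.
have := body_conv h1 h2 i0 i1; congr C.
by apply/rowP => i; rewrite !mxE; field.
Qed.

Lemma body0 : C 0.
Proof. by have [r r0] := body_ball; apply; rewrite normr0. Qed.

Lemma body_scale p k : C p -> 0 <= k -> k <= 1 -> C (k *: p).
Proof. by move=> Cp k0 k1; have := body_conv Cp body0 k0 k1; rewrite scaler0 addr0. Qed.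

Lemma body_bounded : exists2 M : R, 0 < M & forall p, C p -> `|p| <= M.
Proof.
case: C_body => cC _ _; have /compact_bounded[M [Mr hM]] := cC.
exists (`|M| + 1); first by rewrite ltr_wpDl.
by move=> p Cp; apply: (hM _ _ p Cp); rewrite (le_lt_trans (ler_norm _)) // ltrDl.
Qed.

Lemma Cnorm_lb u : has_lbound [set t : R | 0 < t /\ C (t^-1 *: u)].
Proof. by exists 0 => t [/ltW]. Qed.

Lemma Cnorm_ne u : [set t : R | 0 < t /\ C (t^-1 *: u)] !=set0.
Proof.
have [r r0 hr] := body_ball.
have h0 : 0 < (`|u| + 1) / r by rewrite divr_gt0 // ltr_wpDl.
exists ((`|u| + 1) / r); split => //; apply: hr.
rewrite normrZ gtr0_norm ?invr_gt0 // invf_div mulrAC ltr_pdivrMr ?ltr_wpDl //.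
by rewrite ltr_pM2l // ltrDl.
Qed.

Lemma Cnorm_le u t : 0 < t -> C (t^-1 *: u) -> N u <= t.
Proof. by move=> t0 Cu; apply: ge_inf => //; exact: Cnorm_lb. Qed.

Lemma Cnorm_lt u t : N u < t -> C (t^-1 *: u).
Proof.
move=> ut.
have e0 : 0 < t - N u by rewrite subr_gt0.
have [s [s0 Cs]] := inf_adherent e0 (conj (Cnorm_ne u) (Cnorm_lb u)).
rewrite -/(N u) addrC subrK => st.
have t0 : 0 < t by exact: lt_trans st.
rewrite (_ : t^-1 *: u = (s / t) *: (s^-1 *: u)).
  apply: body_scale => //; first by rewrite divr_ge0 // ltW.
  by rewrite ler_pdivrMr // mul1r ltW.
by rewrite scalerA mulrAC divff ?gt_eqF // mul1r.
Qed.

Lemma Cnorm_ge0 u : 0 <= N u.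
Proof. by apply: lb_le_inf; [exact: Cnorm_ne|move=> t [/ltW]]. Qed.

Lemma CnormD u v : N (u + v) <= N u + N v.
Proof.
apply/ler_addgt0Pr => e e0.
have e2 : 0 < e / 2 by rewrite divr_gt0.
set a := N u + e / 2; set b := N v + e / 2.
have a0 : 0 < a by rewrite ltr_wpDl // Cnorm_ge0.
have b0 : 0 < b by rewrite ltr_wpDl // Cnorm_ge0.
have Ca : C (a^-1 *: u) by apply: Cnorm_lt; rewrite ltrDl.
have Cb : C (b^-1 *: v) by apply: Cnorm_lt; rewrite ltrDl.
rewrite (_ : N u + N v + e = a + b); last by rewrite /a /b; field.
apply: Cnorm_le; first by rewrite addr_gt0.
have k0 : 0 <= a / (a + b) by rewrite ltW // divr_gt0 // addr_gt0.
have ab0 : 0 < a + b by exact: addr_gt0.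
have k1 : a / (a + b) <= 1 by rewrite ler_pdivrMr //; lra.
have := body_conv Ca Cb k0 k1; congr C.
apply/rowP => i; rewrite !mxE; field.
by rewrite !gt_eqF // addr_gt0.
Qed.

Lemma CnormN u : N (- u) = N u.
Proof.
have h p : N (- p) <= N p.
  apply/ler_addgt0Pr => e e0; apply: Cnorm_le; first by rewrite ltr_wpDl ?Cnorm_ge0.
  by rewrite scalerN; apply: body_opp; apply: Cnorm_lt; rewrite ltrDl.
by apply/le_anti; rewrite h -{1}[u]opprK h.
Qed.

Lemma CnormZ k u : N (k *: u) = `|k| * N u.
Proof.
have hle a p : 0 < a -> N (a *: p) <= a * N p.
  move=> a0; rewrite -ler_pdivrMl //; apply/ler_addgt0Pr => e e0.
  rewrite ler_pdivrMl //; apply: Cnorm_le.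
    by rewrite mulr_gt0 // ltr_wpDl // Cnorm_ge0.
  rewrite scalerA invfM mulrAC mulVf ?gt_eqF // mul1r.
  by apply: Cnorm_lt; rewrite ltrDl.
have hp a p : 0 < a -> N (a *: p) = a * N p.
  move=> a0; have an : a != 0 by rewrite gt_eqF.
  apply/le_anti; rewrite hle //=.
  by rewrite -ler_pdivlMl // -{1}[p](scalerK an) hle ?invr_gt0.
have [k0|k0|->] := ltgtP k 0.
- by rewrite -CnormN -scaleNr hp ?oppr_gt0 // ltr0_norm.
- by rewrite hp // gtr0_norm.
rewrite scale0r normr0 mul0r; apply/le_anti; rewrite Cnorm_ge0 andbT.
apply/ler_addgt0Pr => e e0; rewrite add0r; apply: Cnorm_le => //.
by rewrite scaler0; exact: body0.
Qed.

Lemma Cnorm0_eq0 p : N p = 0 -> p = 0.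
Proof.
move=> p0; have [M M0 hM] := body_bounded.
apply/eqP; rewrite -normr_le0; apply/ler_addgt0Pr => e e0; rewrite add0r.
have h : 0 < e / M by rewrite divr_gt0.
have := hM _ (@Cnorm_lt p (e / M) _); rewrite p0 => /(_ h).
rewrite normrZ gtr0_norm ?invr_gt0 // invf_div mulrAC ler_pdivrMr //.
by rewrite ler_pM2l.
Qed.

Lemma body_closed : closed C.
Proof. by case: C_body => cC _ _; apply: compact_closed => //; exact: norm_hausdorff. Qed.

Lemma bodyE p : C p <-> N p <= 1.
Proof.
split => [Cp|p1]; first by apply: Cnorm_le => //; rewrite invr1 scale1r.
(* The factor [2^-1] keeps [1 - h / 2] positive also at [n = 0], where [harmonic] is 1. *)
pose u n := p - (harmonic n : R) *: (2^-1 *: p).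
have hu : u @ \oo --> p.
  rewrite (_ : nbhs p = nbhs (p - 0 *: (2^-1 *: p))); last by rewrite scale0r subr0.
  apply: cvgB; first exact: cvg_cst.
  by apply: cvgZl; exact: cvg_harmonic.
apply: (@closed_cvg _ _ \oo _ u _ body_closed _ _ hu); apply: nearW => n /=.
have : 0 < (n.+1%:R : R)^-1 <= 1.
  by rewrite invr_gt0 ltr0Sn /= invf_le1 ?ltr0Sn // ler1n.
rewrite /u /harmonic /=; move: (_^-1) => h /andP[h0 h1].
rewrite (_ : _ - _ = ((1 - h / 2)^-1)^-1 *: p); last by rewrite invrK; vec.
apply/Cnorm_lt/(le_lt_trans p1).
by rewrite -[ltLHS]invr1 ltf_pV2 ?posrE; lra.
Qed.

Lemma Cnorm_bound : exists2 K : R, 0 < K & forall p, N p <= K * `|p|.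
Proof.
have [r r0 hr] := body_ball; exists (2 / r); first by rewrite divr_gt0.
move=> p; have [->|p0] := eqVneq p 0.
  by have := CnormZ 0 0; rewrite scale0r !normr0 mul0r mulr0 => ->.
have np : 0 < `|p| by rewrite normr_gt0.
have h0 : 0 < 2 / r * `|p| by rewrite mulr_gt0 ?divr_gt0.
apply: Cnorm_le => //; apply: hr.
rewrite normrZ gtr0_norm ?invr_gt0 // invfM invf_div -mulrA mulVf ?gt_eqF //.
by lra.
Qed.

Lemma Cnorm_sub_continuous v : continuous (fun q => N (q - v)).
Proof.
have [K K0 hK] := Cnorm_bound.
have h p q : N (p - v) - N (q - v) <= N (p - q).
  by rewrite lerBlDr (_ : p - v = (p - q) + (q - v)) ?CnormD //; vec.
move=> x; have FF : Filter (nbhs x) by exact: nbhs_filter.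
apply/(@cvgrPdist_lt _ _ _ _ FF) => e e0; apply/nbhs_ballP.
exists (e / K) => /=; first by rewrite divr_gt0.
move=> y; rewrite -ball_normE /= ltr_pdivlMr // mulrC => xy.
apply: (@le_lt_trans _ _ (N (x - y))); last exact: le_lt_trans (hK _) xy.
rewrite ler_norml; apply/andP; split; last exact: h.
by rewrite lerNl opprB (le_trans (h _ _)) // -CnormN opprB.
Qed.

Lemma Cnorm_continuous : continuous N.
Proof.
rewrite (_ : N = fun q => N (q - 0)); first exact: Cnorm_sub_continuous.
by apply/funext => q; rewrite subr0.
Qed.

Lemma translateE v p : translate v C p <-> N (p - v) <= 1.
Proof.
rewrite -bodyE; split => [[c Cc <-]|Cp]; first by rewrite addrC addKr.
by exists (p - v) => //; rewrite addrC subrK.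
Qed.

Lemma interior_translate v p : (translate v C)° p <-> N (p - v) < 1.
Proof.
split => [|p1].
  rewrite /interior /= => /nbhs_ballP[r /= r0 hr].
  rewrite ltNge; apply/negP => p1.
  (* A step of relative size [e] away from [v] stays within distance [r] of [p], but raises the norm
     above 1. *)
  pose e := r / (2 * (`|p - v| + 1)).
  have e0 : 0 < e by rewrite divr_gt0 // mulr_gt0 // ltr_wpDl.
  have /translateE : translate v C (p + e *: (p - v)).
    apply: hr; rewrite -ball_normE /= opprD addrA subrr add0r normrN normrZ.
    rewrite gtr0_norm // /e mulrAC ltr_pdivrMr; last by rewrite mulr_gt0 // ltr_wpDl.
    by rewrite ltr_pM2l //; have := normr_ge0 (p - v); lra.
  rewrite (_ : _ - v = (1 + e) *: (p - v)); last by vec.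
  rewrite CnormZ gtr0_norm; last lra.
  have : (1 + e) * 1 <= (1 + e) * N (p - v) by rewrite ler_wpM2l //; lra.
  lra.
rewrite /interior /=.
have oD : open ((fun q => N (q - v)) @^-1` [set x | x < 1]).
  apply: open_comp; last exact: open_lt.
  by move=> q _; exact: Cnorm_sub_continuous.
have /filterS := open_nbhs_nbhs (conj oD p1 : open_nbhs p _).
by apply => q /ltW /translateE.
Qed.

Lemma translate_closed v : closed (translate v C).
Proof.
rewrite (_ : translate v C = (fun q => N (q - v)) @^-1` [set x | x <= 1]).
  apply: closed_comp; last exact: closed_le.
  by move=> q _; exact: Cnorm_sub_continuous.
by apply/seteqP; split => q /translateE.
Qed.

Lemma bd_translate v p : bd (translate v C) p <-> N (p - v) = 1.
Proof.
rewrite /bd -(closure_id _).1; last exact: translate_closed.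
split => [[/translateE h1 h2]|h].
  by apply/le_anti; rewrite h1 leNgt; apply/negP => /interior_translate.
split; first by apply/translateE; rewrite h.
by move/interior_translate; rewrite h ltxx.
Qed.

End BodyNorm.

(** * Lengths of curves *)

Section CurveLength.
Context {R : realType} (C : set 'rV[R]_2).
Context (C_body : plane_convex_body C) (C_sym : o_symmetric C).
Local Notation N := (Cnorm C).
Local Notation pl := (polygonal_length C).
Local Notation cl := (curve_length C).
Implicit Types (p q : 'rV[R]_2) (g : R -> 'rV[R]_2) (s t r : R).

Lemma polygonal_length_cons p q l : pl [:: p, q & l] = N (q - p) + pl (q :: l).
Proof.
by rewrite /polygonal_length /= big_ord_recl /= /Cdist -CnormN // opprB.
Qed.

Lemma polygonal_length1 p : pl [:: p] = 0.
Proof. by rewrite /polygonal_length big_ord0. Qed.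

Lemma polygonal_length0 : pl [::] = 0.
Proof. by rewrite /polygonal_length big_ord0. Qed.

Definition chain s t (l : seq R) := sorted <=%R l /\ {subset l <= `[s, t]}.

Lemma chain_cons s t x l : s <= t ->
  chain s t (x :: l) <-> [/\ s <= x, x <= t & chain x t l].
Proof.
move=> st; split.
  move=> [/= xl hl].
  have /andP[sx xt] : s <= x <= t by have := hl x (mem_head _ _); rewrite in_itv.
  split => //; split; first exact: path_sorted xl.
  move=> y yl; rewrite in_itv /=.
  have := hl y; rewrite inE yl orbT in_itv /= => /(_ isT)/andP[_ ->].
  by rewrite (allP (order_path_min le_trans xl)).
move=> [sx xt [sl hl]]; split.
  rewrite /= path_sortedE; last exact: le_trans.
  by rewrite sl andbT; apply/allP => y /hl; rewrite in_itv => /andP[].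
move=> y; rewrite inE => /predU1P[->|/hl]; rewrite !in_itv /= ?sx //.
by move=> /andP[xy ->]; rewrite (le_trans sx xy).
Qed.

Lemma chain_nil s t : chain s t [::].
Proof. by []. Qed.

Lemma curve_length_ub g s t l : chain s t l -> ((pl (map g l))%:E <= cl g s t)%E.
Proof. by move=> hl; apply: ereal_sup_ubound; exists l. Qed.

Lemma curve_length_le g s t (x : \bar R) :
  (forall l, chain s t l -> ((pl (map g l))%:E <= x)%E) -> (cl g s t <= x)%E.
Proof. by move=> h; apply: ge_ereal_sup => _ [l hl <-]; exact: h. Qed.

Lemma curve_length_ge0 g s t : (0 <= cl g s t)%E.
Proof. by have := @curve_length_ub g s t _ (chain_nil s t); rewrite /= polygonal_length0. Qed.

Lemma curve_length_ge g s t : s <= t -> ((N (g t - g s))%:E <= cl g s t)%E.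
Proof.
move=> st; have := @curve_length_ub g s t [:: s; t].
rewrite /= polygonal_length_cons polygonal_length1 addr0; apply.
by apply/chain_cons => //; split => //; apply/chain_cons.
Qed.

(** The increments of [F] telescope along a polygon; [F] is monotone, which accounts for the two end
    pieces. *)
Lemma curve_length_le_var g s t (F : R -> R) : s <= t ->
  (forall r r', s <= r -> r <= r' -> r' <= t -> N (g r' - g r) <= F r' - F r) ->
  (cl g s t <= (F t - F s)%:E)%E.
Proof.
move=> st h; apply: curve_length_le => l hl; rewrite lee_fin.
have F0 x y : s <= x -> x <= y -> y <= t -> F x <= F y.
  move=> h1 h2 h3; rewrite -subr_ge0 (le_trans _ (h _ _ h1 h2 h3)) //.
  exact: Cnorm_ge0.
case: l hl => [|x l]; first by rewrite /= polygonal_length0 subr_ge0 F0.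
move=> /(chain_cons _ _ st)[sx xt hl].
apply: (@le_trans _ _ (F t - F x)); last by rewrite lerD2l lerN2 F0.
elim: l x sx xt hl => [|y l ih] x sx xt hl.
  by rewrite /= polygonal_length1 subr_ge0 F0.
have [xy yt hl'] := (chain_cons _ _ xt).1 hl.
rewrite /= polygonal_length_cons; have := ih y (le_trans sx xy) yt hl'.
have := h x y sx xy yt; rewrite /=; lra.
Qed.

Lemma polygonal_length_cat p l1 q l2 :
  pl (p :: l1) + pl (q :: l2) <= pl (p :: l1 ++ q :: l2).
Proof.
elim: l1 p => [|x l1 ih] p.
  by rewrite /= polygonal_length1 add0r polygonal_length_cons lerDr Cnorm_ge0.
by rewrite cat_cons !polygonal_length_cons -addrA lerD2l.
Qed.

Lemma chain_cat s r t l1 l2 : s <= r -> r <= t -> chain s r l1 -> chain r t l2 ->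
  chain s t (l1 ++ l2).
Proof.
move=> sr rt h1 h2; elim: l1 s sr h1 => [|x l1 ih] s sr h1.
  case: h2 => h2 h3; split => // y /h3; rewrite !in_itv /= => /andP[h4 ->].
  by rewrite (le_trans sr h4).
have [sx xr hx] := (chain_cons _ _ sr).1 h1.
rewrite cat_cons; apply/chain_cons; first exact: le_trans sr rt.
by split => //; [exact: le_trans xr rt|exact: ih].
Qed.

(** Polygons in the two parts are concatenated. The suprema are taken one at a time by subtracting
    the other term, so an infinite term is treated separately. *)
Lemma curve_length_add_ge g s r t : s <= r -> r <= t ->
  (cl g s r + cl g r t <= cl g s t)%E.
Proof.
move=> sr rt.
have key l1 l2 : chain s r l1 -> chain r t l2 ->
    ((pl (map g l1))%:E + (pl (map g l2))%:E <= cl g s t)%E.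
  move=> h1 h2; have h := chain_cat sr rt h1 h2.
  apply: le_trans (curve_length_ub g h); rewrite -EFinD lee_fin map_cat.
  case: l1 {h1 h} => [|x l1]; first by rewrite /= polygonal_length0 add0r.
  case: l2 {h2} => [|y l2]; first by rewrite /= polygonal_length0 addr0 cats0.
  exact: polygonal_length_cat.
have key1 l1 : chain s r l1 -> ((pl (map g l1))%:E + cl g r t <= cl g s t)%E.
  move=> h1; rewrite addeC -leeBrDr //; apply: curve_length_le => l2 h2.
  by rewrite leeBrDr // addeC key.
have [h|h] := eqVneq (cl g r t) +oo%E.
  have := key1 _ (chain_nil s r); rewrite /= polygonal_length0 add0e h leye_eq => /eqP ->.
  exact: leey.
have fB : cl g r t \is a fin_num.
  by rewrite ge0_fin_numE ?curve_length_ge0 // ltey.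
by rewrite -leeBrDr //; apply: curve_length_le => l1 h1; rewrite leeBrDr // key1.
Qed.

Lemma curve_length_add g s r t : s <= r -> r <= t -> cl g s t = (cl g s r + cl g r t)%E.
Proof.
move=> sr rt; apply/le_anti; rewrite curve_length_add_ge // andbT.
apply: curve_length_le => -[|x l] hl.
  by rewrite /= polygonal_length0 adde_ge0 ?curve_length_ge0.
have [sx xt {}hl] := (chain_cons _ _ (le_trans sr rt)).1 hl.
have far y : r <= y -> y <= t -> forall l, chain y t l ->
    ((pl (map g (y :: l)))%:E <= cl g r t)%E.
  by move=> ry yt l' hl'; apply: curve_length_ub; apply/chain_cons.
have [xr|/ltW rx] := leP x r; last first.
  by rewrite (le_trans (far _ rx xt _ hl)) // leeDr // curve_length_ge0.
suff h : ((pl (map g (x :: l)))%:E <= cl g x r + cl g r t)%E.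
  apply: (le_trans h); rewrite leeD2r //.
  apply: le_trans (curve_length_add_ge g sx xr); rewrite leeDr //; exact: curve_length_ge0.
elim: l x {sx} xt hl xr => [|y l ih] x xt hl xr.
  by rewrite /= polygonal_length1 adde_ge0 ?curve_length_ge0.
have [xy yt hl'] := (chain_cons _ _ xt).1 hl.
have [yr|/ltW ry] := leP y r.
  rewrite /= polygonal_length_cons EFinD.
  apply: (@le_trans _ _ (cl g x y + (cl g y r + cl g r t))%E).
    by apply: leeD; [exact: curve_length_ge|exact: ih].
  by rewrite addeA leeD2r // curve_length_add_ge.
(* The edge from [x] to [y] passes over [r]; inserting [r] as a vertex does not shorten the
   polygon. *)
apply: (@le_trans _ _ ((N (g r - g x))%:E + (pl (map g (r :: y :: l)))%:E)%E).
  rewrite -EFinD lee_fin /= !polygonal_length_cons addrA lerD2r.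
  by rewrite (_ : g y - g x = (g r - g x) + (g y - g r)) ?CnormD //; vec.
apply: leeD; first exact: curve_length_ge.
by apply: far => //; apply/chain_cons.
Qed.

Lemma curve_length_reparam g g' (f : R -> R) s t s' t' :
  {homo f : x y / x <= y} -> s' <= f s -> f t <= t' ->
  (forall x y, N (g y - g x) = N (g' (f y) - g' (f x))) ->
  (cl g s t <= cl g' s' t')%E.
Proof.
move=> mf hs ht h; apply: curve_length_le => l [sl hl].
have -> : pl (map g l) = pl (map g' (map f l)).
  elim: l {sl hl} => [|x [|y l] ih]; rewrite /= ?polygonal_length0 ?polygonal_length1 //.
  by rewrite !polygonal_length_cons h; congr (_ + _).
apply: curve_length_ub; split; first exact: homo_sorted sl.
move=> _ /mapP[y /hl yl ->]; move: yl; rewrite !in_itv /= => /andP[sy yt].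
by rewrite (le_trans hs) ?mf // (le_trans _ ht) // mf.
Qed.

Lemma curve_length_translate g v s t : cl (fun x => v + g x) s t = cl g s t.
Proof.
by apply/le_anti/andP; split; apply: (curve_length_reparam (f := id)) => // x y;
  congr N; vec.
Qed.

End CurveLength.

(** * The boundary of the body as a circle *)

Section Direction.
Context {R : realType}.

Definition dir (t : R) : 'rV[R]_2 := cos t *: delta_mx 0 0 + sin t *: delta_mx 0 1.

Lemma dir0 t : dir t 0 0 = cos t.
Proof. by rewrite !mxE /=; ring. Qed.

Lemma dir1 t : dir t 0 1 = sin t.
Proof. by rewrite !mxE /=; ring. Qed.

Lemma det_dir s t : det (dir s) (dir t) = sin (t - s).
Proof. by rewrite /det !dir0 !dir1 sinB; ring. Qed.

Lemma dir_neq0 t : dir t != 0.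
Proof.
apply/eqP => h; have := cos2Dsin2 t.
by rewrite -dir0 -dir1 h !mxE !expr0n addr0 => /esym/eqP; rewrite oner_eq0.
Qed.

Lemma dirDpi t : dir (t + pi) = - dir t.
Proof. by rewrite /dir cosDpi sinDpi !scaleNr opprD. Qed.

Lemma dir_continuous : continuous dir.
Proof.
move=> t; apply: cvgD.
  by apply: cvgZl; exact: continuous_cos.
by apply: cvgZl; exact: continuous_sin.
Qed.

Lemma polar (p : 'rV[R]_2) : p != 0 -> exists k t, 0 < k /\ p = k *: dir t.
Proof.
move=> p0; set x := p 0 0; set y := p 0 1.
have D0 : 0 < x ^+ 2 + y ^+ 2.
  rewrite lt0r addr_ge0 ?sqr_ge0 // andbT paddr_eq0 ?sqr_ge0 // !sqrf_eq0.
  apply: contra p0 => /andP[/eqP hx /eqP hy]; apply/eqP/rowP => i; rewrite mxE.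
  by case: (ord2P i) => ->.
pose k := Num.sqrt (x ^+ 2 + y ^+ 2).
have k0 : 0 < k by rewrite sqrtr_gt0.
have kk : k ^+ 2 = x ^+ 2 + y ^+ 2 by rewrite sqr_sqrtr // ltW.
have xk : -1 <= x / k <= 1.
  rewrite -ler_norml normrM normfV (gtr0_norm k0) ler_pdivrMr // mul1r.
  by rewrite -[k]gtr0_norm // -ler_sqr ?nnegrE // !real_normK ?num_real // kk lerDl sqr_ge0.
have hc : cos (acos (x / k)) = x / k by rewrite acosK // in_itv.
have s0 : 0 <= sin (acos (x / k)).
  by apply: sin_ge0_pi; rewrite acos_ge0 // acos_lepi.
have hs : k * sin (acos (x / k)) = `|y|.
  apply/eqP; rewrite -(@eqrXn2 _ 2) // ?mulr_ge0 ?(ltW k0) //.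
  rewrite exprMn sin2cos2 hc mulrBr mulr1 expr_div_n real_normK ?num_real //.
  rewrite mulrCA divff ?mulr1; last by rewrite expf_neq0 // gt_eqF.
  rewrite kk.
  by apply/eqP; ring.
have hx : k * cos (acos (x / k)) = x by rewrite hc mulrC divfK ?gt_eqF.
have [y0|/ltW y0] := leP 0 y.
  exists k, (acos (x / k)); split => //; apply/rowP => i; rewrite mxE.
  by case: (ord2P i) => ->; rewrite ?dir0 ?dir1 ?hx ?hs ?ger0_norm.
exists k, (- acos (x / k)); split => //; apply/rowP => i; rewrite mxE.
case: (ord2P i) => ->; rewrite ?dir0 ?dir1 ?cosN ?sinN ?hx //.
by rewrite mulrN hs ler0_norm // opprK.
Qed.

End Direction.

Section BodyCircle.
Context {R : realType} (C : set 'rV[R]_2).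
Context (C_body : plane_convex_body C) (C_sym : o_symmetric C).
Local Notation N := (Cnorm C).

Definition bdpt (t : R) : 'rV[R]_2 := (N (dir t))^-1 *: dir t.

Lemma Cnorm_dir_gt0 t : 0 < N (dir t).
Proof.
rewrite lt0r Cnorm_ge0 // andbT; apply/eqP => /(Cnorm0_eq0 C_body C_sym).
exact/eqP/dir_neq0.
Qed.

Lemma Cnorm_bdpt t : N (bdpt t) = 1.
Proof.
by rewrite CnormZ // gtr0_norm ?invr_gt0 ?Cnorm_dir_gt0 // mulVf // gt_eqF ?Cnorm_dir_gt0.
Qed.

Lemma bdptDpi t : bdpt (t + pi) = - bdpt t.
Proof. by rewrite /bdpt dirDpi CnormN // scalerN. Qed.

Lemma bdpt_onto p : N p = 1 -> exists t, p = bdpt t.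
Proof.
move=> p1; have p0 : p != 0.
  apply/eqP => pz; move: p1; rewrite pz.
  have := CnormZ C_body C_sym 0 0; rewrite scale0r normr0 mul0r => -> /eqP.
  by rewrite eq_sym oner_eq0.
have [k [t [k0 e]]] := polar p0; exists t.
have := p1; rewrite e CnormZ // gtr0_norm // => kN.
rewrite /bdpt; congr (_ *: _).
by rewrite -[LHS](mulfK (lt0r_neq0 (Cnorm_dir_gt0 t))) kN mul1r.
Qed.

Lemma bdpt_continuous : continuous bdpt.
Proof.
move=> t; apply: cvgZ; last exact: dir_continuous.
apply: cvgV; first by rewrite gt_eqF ?Cnorm_dir_gt0.
apply: (@continuous_comp _ _ _ dir N); first exact: dir_continuous.
exact: Cnorm_continuous.
Qed.

Lemma det_bdpt s t :
  det (bdpt s) (bdpt t) = (N (dir s))^-1 * (N (dir t))^-1 * sin (t - s).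
Proof. by rewrite -det_dir /det !mxE; ring. Qed.

(** [ori] is 1 because [det_bdpt] is a positive multiple of [sin (t - s)]. The half turn preserves
    lengths because it negates the points. *)
Definition body_circle : circle R.
Proof.
refine (@Circle R N 1 bdpt (curve_length C bdpt) (CnormD C_body C_sym)
  (CnormZ C_body C_sym) (Cnorm0_eq0 C_body C_sym) (Cnorm_continuous C_body C_sym)
  Cnorm_bdpt bdpt_onto bdpt_continuous bdptDpi _ _ _ _ _).
- move=> s t /andP[st ts]; rewrite mul1r det_bdpt.
  by rewrite !mulr_gt0 ?invr_gt0 ?Cnorm_dir_gt0 // sin_gt0_pi //; lra.
- by move=> s r t /andP[]; exact: curve_length_add.
- exact: curve_length_ge.
- move=> s t st; apply/le_anti/andP; split.
    apply: (@curve_length_reparam _ _ C_body C_sym _ _ (fun x => x - pi)).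
    + by move=> x y; rewrite lerD2r.
    + lra.
    + lra.
    + move=> x y; rewrite -[x in LHS](subrK pi) -[y in LHS](subrK pi) !bdptDpi.
      by rewrite -CnormN // opprB opprK addrC.
  apply: (@curve_length_reparam _ _ C_body C_sym _ _ (fun x => x + pi)).
  + by move=> x y; rewrite lerD2r.
  + exact: lexx.
  + exact: lexx.
  + by move=> x y; rewrite !bdptDpi -[RHS]CnormN // opprB opprK addrC.
- by move=> s t F; exact: curve_length_le_var.
Defined.

End BodyCircle.

(** * Arcs contained in the boundary *)

Section Reversal.
Context {R : realType} (C : set 'rV[R]_2).
Context (C_body : plane_convex_body C) (C_sym : o_symmetric C).
Local Notation N := (Cnorm C).
Local Notation pl := (polygonal_length C).
Implicit Types (p q : 'rV[R]_2) (g : R -> 'rV[R]_2) (s t r : R).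

Lemma polygonal_length_rcons l q p : pl (rcons (rcons l q) p) = pl (rcons l q) + N (p - q).
Proof.
elim: l => [|x l ih]; first by rewrite /= polygonal_length_cons // !polygonal_length1 addrC.
case: l ih => [_|y l ih]; first by rewrite /= !polygonal_length_cons // !polygonal_length1 !addr0.
have e k : pl (x :: y :: k) = N (y - x) + pl (y :: k) by exact: polygonal_length_cons.
by rewrite !rcons_cons !e -addrA; congr (_ + _); exact: ih.
Qed.

Lemma polygonal_length_rev l : pl (rev l) = pl l.
Proof.
elim: l => [|x [|y l] ih] //.
rewrite !rev_cons polygonal_length_rcons -rev_cons ih polygonal_length_cons //.
by rewrite addrC -CnormN // opprB.
Qed.

Lemma chain_rev s t l : chain s t l -> chain (- t) (- s) (rev (map -%R l)).
Proof.
move=> [sl hl]; split.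
  rewrite rev_sorted sorted_map; apply: sub_sorted sl => x y /=.
  by rewrite lerN2.
move=> x; rewrite mem_rev => /mapP[y /hl + ->].
by rewrite !in_itv /= !lerN2 andbC.
Qed.

End Reversal.

(* A curve [h] that runs through the points of [gm] in increasing order is at
   least as long as [gm]; [r1] separates the start [s] from the other vertices
   of the polygon at hand. *)
Section Following.
Context {R : realType} (h gm : R -> 'rV[R]_2) (a b s t r1 tau0 rho0 : R).
Hypotheses (ab : a <= b) (ha : h a = gm s) (at0 : a <= tau0) (t0b : tau0 <= b)
  (st : s <= t) (ht0 : h tau0 = gm rho0) (s0 : s < rho0) (r01 : rho0 <= r1).
Hypothesis hit : forall tau rho r, tau0 <= tau -> tau <= b -> s < rho ->
  h tau = gm rho -> rho <= r -> r <= t ->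
  exists tau', [/\ tau <= tau', tau' <= b & h tau' = gm r].

Lemma follow_from l tau rho : tau0 <= tau -> tau <= b -> s < rho -> rho <= t ->
  h tau = gm rho -> chain rho t l ->
  exists ts, chain tau b ts /\ map h ts = map gm l.
Proof.
elim: l tau rho => [|x l ih] tau rho h1 h2 h3 h4 h5 hc.
  by exists [::]; split.
have [rx xt hc'] := (chain_cons _ _ h4).1 hc.
have [tau' [k1 k2 k3]] := hit h1 h2 h3 h5 rx xt.
have [ts [c1 c2]] := ih tau' x (le_trans h1 k1) k2 (lt_le_trans h3 rx) xt k3 hc'.
by exists (tau' :: ts); split; [apply/chain_cons|rewrite /= k3 c2].
Qed.

Lemma follow l : chain s t l -> {in l, forall x, x = s \/ r1 <= x} ->
  exists ts, chain a b ts /\ map h ts = map gm l.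
Proof.
elim: l => [|x l ih] hc hl; first by exists [::]; split.
have [sx xt hc'] := (chain_cons _ _ st).1 hc.
have [xs|rx] := hl x (mem_head _ _).
  rewrite xs in hc'; have [|ts [c1 c2]] := ih hc'.
    by move=> y yl; apply: hl; rewrite inE yl orbT.
  by exists (a :: ts); split; [apply/chain_cons|rewrite /= ha c2 xs].
have [tau' [k1 k2 k3]] := hit (lexx _) t0b s0 ht0 (le_trans r01 rx) xt.
have sx' : s < x by rewrite (lt_le_trans s0) // (le_trans r01).
have [ts [c1 c2]] := follow_from k1 k2 sx' xt k3 hc'.
exists (tau' :: ts); split; last by rewrite /= k3 c2.
by apply/chain_cons => //; split => //; apply: le_trans k1.
Qed.

End Following.

(** A polygon has finitely many vertices, so those other than [s] stay away from it. This supplies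
    [r1] for [follow]. *)
Lemma separate_start {R : realType} (s t : R) l : s < t -> chain s t l ->
  exists r, [/\ s < r, r <= t & {in l, forall x, x = s \/ r <= x}].
Proof.
move=> st; elim: l => [|x l ih] hc; first by exists t; split.
have [sx xt hc'] := (chain_cons _ _ (ltW st)).1 hc.
have [|r [sr rt hr]] := ih.
  by case: hc => /= /path_sorted hs hl; split => // y yl; apply: hl; rewrite inE yl orbT.
have [xs|xs] := eqVneq x s.
  exists r; split => // y; rewrite inE => /predU1P[->|/hr //]; by left.
exists (Num.min x r); split.
- by rewrite lt_min sr andbT lt_neqAle eq_sym xs.
- by rewrite ge_min xt.
move=> y; rewrite inE => /predU1P[->|/hr[->|ry]]; [right|by left|right].
  by rewrite ge_min lexx.
by rewrite ge_min ry orbT.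
Qed.

Section Stereographic.
Context {R : realType} (s : R).
Implicit Types (p q : 'rV[R]_2).

(* Stereographic projection, from the point of direction [s], of the Euclidean
   unit vector along [p]. *)
Definition stereo p : R :=
  det (dir s) p / (Num.sqrt (p 0 0 ^+ 2 + p 0 1 ^+ 2) - (cos s * p 0 0 + sin s * p 0 1)).

Lemma stereo_den k r : 0 < k ->
  Num.sqrt ((k *: dir r) 0 0 ^+ 2 + (k *: dir r) 0 1 ^+ 2) -
  (cos s * (k *: dir r) 0 0 + sin s * (k *: dir r) 0 1) = k * (1 - cos (r - s)).
Proof.
move=> k0; rewrite ![(k *: dir r) _ _]mxE !dir0 !dir1 !exprMn -mulrDr cos2Dsin2.
by rewrite mulr1 sqrtr_sqr gtr0_norm // cosB; ring.
Qed.

Lemma half_angle (x : R) : 0 < x -> x < pi + pi ->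
  exists c d, [/\ 0 < d, 1 - cos x = 2 * d ^+ 2 & sin x = 2 * c * d]
    /\ c = cos (x / 2) /\ d = sin (x / 2).
Proof.
move=> x0 x2; exists (cos (x / 2)), (sin (x / 2)); split => //.
have e : x = x / 2 + x / 2 by field.
split.
- by apply: sin_gt0_pi; lra.
- by rewrite {1}e cosD; have := cos2Dsin2 (x / 2); lra.
- by rewrite {1}e sinD; ring.
Qed.

(** Half-angle formulas give a cotangent, which is monotone in the angle. As [stereo] is continuous
    in the point, paths can be treated by the intermediate value theorem without lifting them to
    angles. *)
Lemma stereoE k r : 0 < k -> s < r -> r < s + (pi + pi) ->
  stereo (k *: dir r) = cos ((r - s) / 2) / sin ((r - s) / 2).
Proof.
move=> k0 sr rs; rewrite /stereo stereo_den //.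
have [||c [d [[d0 -> e2] [<- <-]]]] := @half_angle (r - s); try lra.
rewrite (_ : det (dir s) (k *: dir r) = k * sin (r - s)); last first.
  by rewrite -det_dir /det !mxE; ring.
by rewrite e2; field; rewrite !gt_eqF.
Qed.

Lemma stereo_decr k k' r r' : 0 < k -> 0 < k' -> s < r -> r < r' ->
  r' < s + (pi + pi) -> stereo (k' *: dir r') < stereo (k *: dir r).
Proof.
move=> k0 k0' h1 h2 h3; rewrite !stereoE //; try lra.
have d0 : 0 < sin ((r - s) / 2) by apply: sin_gt0_pi; lra.
have d0' : 0 < sin ((r' - s) / 2) by apply: sin_gt0_pi; lra.
rewrite ltr_pdivrMr // mulrAC ltr_pdivlMr // -subr_gt0.
have : 0 < sin ((r' - s) / 2 - (r - s) / 2) by apply: sin_gt0_pi; lra.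
by rewrite sinB; lra.
Qed.

Lemma cvg_stereo {T : Type} {F : set_system T} {FF : Filter F} (f : T -> 'rV[R]_2) p :
  (fun x => f x 0 0) @ F --> p 0 0 -> (fun x => f x 0 1) @ F --> p 0 1 ->
  Num.sqrt (p 0 0 ^+ 2 + p 0 1 ^+ 2) - (cos s * p 0 0 + sin s * p 0 1) != 0 ->
  (fun x => stereo (f x)) @ F --> stereo p.
Proof.
move=> c0 c1 hp; apply: cvgM.
  apply: cvgB; apply: cvgM => //; exact: cvg_cst.
apply: cvgV => //; apply: cvgB.
  apply: (@cvg_comp _ _ _ (fun x => f x 0 0 ^+ 2 + f x 0 1 ^+ 2) Num.sqrt).
    apply: cvgD.
      apply: (@cvg_comp _ _ _ (fun x => f x 0 0) (fun y => y ^+ 2) _ _ _ c0).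
      exact: exprn_continuous.
    apply: (@cvg_comp _ _ _ (fun x => f x 0 1) (fun y => y ^+ 2) _ _ _ c1).
    exact: exprn_continuous.
  exact: sqrt_continuous.
by apply: cvgD; apply: cvgM => //; exact: cvg_cst.
Qed.

End Stereographic.

(** * Paths on the boundary *)

Section ArcLowerBound.
Context {R : realType} (C : set 'rV[R]_2).
Context (C_body : plane_convex_body C) (C_sym : o_symmetric C).
Local Notation N := (Cnorm C).
Local Notation G := (bdpt C).

Lemma within_stereo s (h : R -> 'rV[R]_2) a b c : a < c -> c <= b ->
  {within `[a, b], continuous h} ->
  (forall x, a < x -> x <= b -> exists k u,
    [/\ 0 < k, s < u, u < s + (pi + pi) & h x = k *: dir u]) ->
  {within `[c, b], continuous (fun x => stereo s (h x))}.
Proof.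
move=> ac cb cont_h hk.
have cont_h' : {within `[c, b], continuous h}.
  apply: continuous_subspaceW cont_h => x /=; rewrite !in_itv /= => /andP[cx ->].
  by rewrite (le_trans (ltW ac) cx).
apply/subspace_continuousP => x; rewrite /= in_itv /= => /andP[cx xb].
have /subspace_continuousP/(_ x) := cont_h'; rewrite /= in_itv /= cx xb => /(_ isT) hx.
have [k [u [k0 su us e]]] := hk x (lt_le_trans ac cx) xb.
apply: cvg_stereo.
- apply: (@cvg_comp _ _ _ h (fun M : 'rV[R]_2 => M 0 0) _ _ _ hx).
  exact: coord_continuous.
- apply: (@cvg_comp _ _ _ h (fun M : 'rV[R]_2 => M 0 1) _ _ _ hx).
  exact: coord_continuous.
rewrite e stereo_den // mulf_neq0 ?gt_eqF //.
have [||c' [d [[d0 -> _] _]]] := @half_angle _ (u - s); try lra.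
by rewrite mulr_gt0 // exprn_gt0.
Qed.

Lemma bdpt_scaled u : G u = (N (dir u))^-1 *: dir u.
Proof. by []. Qed.

Lemma Cnorm_dir_inv_gt0 u : 0 < (N (dir u))^-1.
Proof. by rewrite invr_gt0; exact: Cnorm_dir_gt0. Qed.

Lemma bdptD2pi u : G (u + (pi + pi)) = G u.
Proof. by rewrite addrA !bdptDpi // opprK. Qed.

Lemma unit_param s p : N p = 1 -> p != G s ->
  exists u, [/\ s < u, u < s + (pi + pi) & p = G u].
Proof.
move=> p1 ps.
have [u [u1 u2 e]] := @gam_onto_near _ (body_circle C_body C_sym) (s + pi) p p1.
exists u; split => //; first lra.
rewrite lt_neqAle (_ : u <= _) ?andbT; last lra.
by apply: contra_neq ps => us; rewrite e /= us bdptD2pi.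
Qed.

(** The intermediate value theorem for the stereographic projection of the path from [G s]; the
    projection is injective on the boundary without [G s]. *)
Lemma path_hit (h : R -> 'rV[R]_2) a b s t c rho r :
  {within `[a, b], continuous h} ->
  (forall x, a <= x -> x <= b -> N (h x) = 1) ->
  (forall x, a < x -> x <= b -> h x != G s) ->
  a < c -> c <= b -> h c = G rho -> h b = G t ->
  s < rho -> rho < s + (pi + pi) -> s < t -> t < s + (pi + pi) ->
  Num.min rho t <= r -> r <= Num.max rho t ->
  exists x, [/\ c <= x, x <= b & h x = G r].
Proof.
move=> cont_h h1 hs ac cb hc hb srho rhos st ts r1 r2.
have hu x : a < x -> x <= b -> exists u, [/\ s < u, u < s + (pi + pi) & h x = G u].
  by move=> ax xb; apply: unit_param; rewrite ?h1 ?hs // ltW.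
have hk x : a < x -> x <= b -> exists k u,
    [/\ 0 < k, s < u, u < s + (pi + pi) & h x = k *: dir u].
  move=> ax xb; have [u [u1 u2 ->]] := hu x ax xb.
  by exists (N (dir u))^-1, u; split => //; exact: Cnorm_dir_inv_gt0.
have mono u v : s < u -> u <= v -> v < s + (pi + pi) -> stereo s (G v) <= stereo s (G u).
  move=> su; rewrite le_eqVlt => /predU1P[<- //|uv] vs.
  by rewrite ltW // stereo_decr // Cnorm_dir_inv_gt0.
have sr : s < r by apply: lt_le_trans r1; rewrite lt_min srho.
have rs : r < s + (pi + pi) by apply: le_lt_trans r2 _; rewrite gt_max rhos.
have [|x] := IVT (v := stereo s (G r)) cb (within_stereo ac cb cont_h hk).
  rewrite hc hb ge_min le_max.
  have [rt|/ltW tr] := leP rho t.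
    move: r1 r2; rewrite min_l // max_r // => r1 r2.
    by apply/andP; split; apply/orP; [right|left]; apply: mono.
  move: r1 r2; rewrite min_r // max_l // => r1 r2.
  by apply/andP; split; apply/orP; [left|right]; apply: mono.
rewrite in_itv /= => /andP[cx xb] e; exists x; split => //.
have [u [u1 u2 eu]] := hu x (lt_le_trans ac cx) xb.
rewrite eu; congr G; apply/eqP; rewrite eq_le !leNgt; apply/andP; split; apply/negP => ur.
  have := @stereo_decr _ s _ _ _ _ (Cnorm_dir_inv_gt0 r) (Cnorm_dir_inv_gt0 u) sr ur u2.
  by rewrite -!bdpt_scaled -eu e ltxx.
have := @stereo_decr _ s _ _ _ _ (Cnorm_dir_inv_gt0 u) (Cnorm_dir_inv_gt0 r) u1 ur rs.
by rewrite -!bdpt_scaled -eu e ltxx.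
Qed.

Lemma bdpt_neq s r : s < r -> r < s + (pi + pi) -> G r != G s.
Proof.
move=> sr rs; have [h|h] := leP r (s + pi).
  by rewrite -subr_eq0; exact: (@chord_neq0 _ (body_circle C_body C_sym) s r).
rewrite eq_sym -(bdptD2pi s) -subr_eq0.
by apply: (@chord_neq0 _ (body_circle C_body C_sym) r (s + (pi + pi))) => //; lra.
Qed.

(** The points with parameters in [[r1, r2]] keep a positive distance [de] from [G s]. The path
    starts at [G s], so it passes through a smaller positive distance. *)
Lemma near_start (h : R -> 'rV[R]_2) a b s t r1 r2 : a < b ->
  {within `[a, b], continuous h} ->
  (forall x, a <= x -> x <= b -> N (h x) = 1) ->
  (forall x, a < x -> x <= b -> h x != G s) ->
  h a = G s -> h b = G t ->
  s < r1 -> r1 <= t -> t <= r2 -> r2 < s + (pi + pi) ->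
  exists c rho, [/\ a < c, c <= b, h c = G rho &
    [/\ s < rho, rho < s + (pi + pi) & rho < r1 \/ r2 < rho]].
Proof.
move=> ab cont_h h1 hs ha hb sr1 r1t tr2 r2s.
have pos p : p != G s -> 0 < N (p - G s).
  move=> ps; rewrite lt0r Cnorm_ge0 // andbT; apply: contra ps => /eqP.
  by move=> /(Cnorm0_eq0 C_body C_sym) /eqP; rewrite subr_eq0.
have cN := @Cnorm_sub_continuous _ _ C_body C_sym (G s).
have [|m] := @EVT_min R (fun r => N (G r - G s)) r1 r2 (le_trans r1t tr2).
  apply: continuous_subspaceT => x.
  apply: (@continuous_comp _ _ _ G (fun q => N (q - G s))); last exact: cN.
  exact: bdpt_continuous.
rewrite in_itv /= => /andP[m1 m2]; set de := N (G m - G s) => hm.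
have d0 : 0 < de.
  by apply: pos; apply: bdpt_neq; [apply: lt_le_trans m1|apply: le_lt_trans r2s].
have cf : {within `[a, b], continuous (fun x => N (h x - G s))}.
  apply/subspace_continuousP => x xab.
  have /subspace_continuousP/(_ x xab) hx := cont_h.
  by apply: (@cvg_comp _ _ _ h (fun q => N (q - G s)) _ _ _ hx); exact: cN.
have fb : 0 < N (h b - G s) by apply: pos; exact: hs.
have f0 : N (h a - G s) = 0.
  rewrite ha subrr; have := CnormZ C_body C_sym 0 0.
  by rewrite scale0r normr0 mul0r.
pose e := Num.min (N (h b - G s)) de / 2.
have e0 : 0 < e by rewrite divr_gt0 // lt_min fb.
have eb : e < N (h b - G s).
  have : Num.min (N (h b - G s)) de <= N (h b - G s) by rewrite ge_min lexx.
  by move: e0; rewrite /e; lra.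
have ed : e < de.
  have : Num.min (N (h b - G s)) de <= de by rewrite ge_min lexx orbT.
  by move: e0; rewrite /e; lra.
have [|c] := IVT (v := e) (ltW ab) cf.
  rewrite f0 min_l ?max_r ?(ltW fb) // (ltW e0) /=.
  exact: ltW.
rewrite in_itv /= => /andP[ac cb] ec.
have ac' : a < c.
  rewrite lt_neqAle ac andbT; apply/eqP => ca.
  by move: ec e0; rewrite -ca f0 => <-; rewrite ltxx.
have [rho [u1 u2 eu]] := unit_param (h1 c ac cb) (hs c ac' cb).
exists c, rho; split => //; split => //.
have [k1|k1] := ltP rho r1; [by left|right].
rewrite ltNge; apply/negP => k2.
have := hm rho; rewrite in_itv /= k1 k2 => /(_ isT).
by rewrite -eu ec leNgt ed.
Qed.

End ArcLowerBound.

Section ArcDistance.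
Context {R : realType} (C : set 'rV[R]_2).
Context (C_body : plane_convex_body C) (C_sym : o_symmetric C).
Local Notation N := (Cnorm C).
Local Notation G := (bdpt C).
Local Notation S := (body_circle C_body C_sym).
Local Notation cl := (curve_length C).

(** If both bounds failed, each arc would have an inscribed polygon longer than the path. By
    [near_start] the path has a point on one side of [G s] ahead of the vertices there, and from it
    [follow] runs through that polygon, a contradiction. *)
Lemma path_length_ge (h : R -> 'rV[R]_2) a b s t : a < b ->
  {within `[a, b], continuous h} ->
  (forall x, a <= x -> x <= b -> N (h x) = 1) ->
  (forall x, a < x -> x <= b -> h x != G s) ->
  h a = G s -> h b = G t -> s < t -> t < s + (pi + pi) ->
  (cl G s t <= cl h a b)%E \/ (cl G t (s + (pi + pi)) <= cl h a b)%E.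
Proof.
move=> ab cont_h h1 hs ha hb st ts; apply: contrapT => /not_orP[].
move=> /negP; rewrite -ltNge => /ereal_sup_gt[_ [l1 hl1 <-] lt1].
move=> /negP; rewrite -ltNge => /ereal_sup_gt[_ [l2 hl2 <-] lt2].
have [r1 [sr1 r1t hr1]] := separate_start st hl1.
have ts' : - (s + (pi + pi)) < - t by rewrite ltrN2.
have hl2' := chain_rev hl2.
have [r2 [sr2 r2t hr2]] := separate_start ts' hl2'.
have [||c [rho [ac cb hc [srho rhos hrho]]]] :=
  @near_start _ _ C_body C_sym h a b s t r1 (- r2) ab cont_h h1 hs ha hb sr1 r1t; try lra.
have hit tau u r : c <= tau -> tau <= b -> s < u -> u < s + (pi + pi) -> h tau = G u ->
    Num.min u t <= r -> r <= Num.max u t ->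
    exists x, [/\ tau <= x, x <= b & h x = G r].
  move=> ct tb su us hu; apply: (path_hit C_body C_sym cont_h h1 hs _ tb hu hb) => //.
  exact: lt_le_trans ct.
case: hrho => hrho.
  have [|ts2 [c1 c2]] := follow (ltW ab) ha (ltW ac) cb (ltW st) hc srho (ltW hrho) _ hl1 hr1.
    move=> tau u r ct tb su hu ur rt; apply: (hit tau u r) => //; first lra.
      by rewrite ge_min ur.
    by rewrite le_max rt orbT.
  by move: lt1; rewrite -c2 ltNge curve_length_ub.
(* On the other side the path runs clockwise; with negated parameters it starts at
   [- (s + (pi + pi))]. *)
pose gm x := G (- x).
have ha' : h a = gm (- (s + (pi + pi))) by rewrite ha /gm opprK (bdptD2pi C_body C_sym).
have hc' : h c = gm (- rho) by rewrite hc /gm opprK.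
have srho' : - (s + (pi + pi)) < - rho by rewrite ltrN2.
have r01' : - rho <= r2 by lra.
have [|ts2 [c1 c2]] := @follow _ h gm a b _ _ r2 c (- rho) (ltW ab) ha' (ltW ac) cb
    (ltW ts') hc' srho' r01' _ _ hl2' hr2.
  move=> tau u r ct tb su hu ur rt.
  have us : s < - u by lra.
  have us' : - u < s + (pi + pi) by lra.
  have m1 : Num.min (- u) t <= - r by rewrite ge_min; apply/orP; right; lra.
  have m2 : - r <= Num.max (- u) t by rewrite le_max lerN2 ur.
  have [x [x1 x2 x3]] := hit tau (- u) (- r) ct tb us us' hu m1 m2.
  by exists x; rewrite /gm.
move: lt2; rewrite ltNge -(polygonal_length_rev C_body C_sym) -map_rev.
have -> : map G (rev l2) = map gm (rev (map -%R l2)).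
  by rewrite -map_rev -map_comp; apply: eq_map => x; rewrite /gm /= opprK.
by rewrite -c2 curve_length_ub.
Qed.

Lemma arc_distance_le p q s t : arc_of S (q - p) s t ->
  (arc_distance C p q <= len S s t)%E.
Proof.
move=> [st ts e]; apply: ereal_inf_lbound.
pose v := p - G s.
exists v, (fun x => v + G x), s, t; split.
- split => //.
  + apply: continuous_subspaceT => x; apply: cvgD; first exact: cvg_cst.
    exact: bdpt_continuous.
  + move=> x y; rewrite !in_itv /= => /andP[sx xt] /andP[sy yt] /addrI exy.
    have h u w : s <= u -> u < w -> w <= t -> G u != G w.
      move=> su uw wt; rewrite eq_sym; apply: bdpt_neq => //.
      by have := pi_gt0 R; lra.
    case: (ltgtP x y) => // xy.
    * by have := h _ _ sx xy yt; rewrite exy eqxx.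
    * by have := h _ _ sy xy xt; rewrite exy eqxx.
  + by rewrite /v subrK.
  + rewrite /v -[q in RHS](subrK p) -e /chord /=; vec.
- move=> _ [x _ <-]; apply/bd_translate => //.
  by rewrite addrC addKr Cnorm_bdpt.
- by rewrite curve_length_translate.
Qed.

(** By [path_length_ge] a competing arc is at least as long as one of the two boundary arcs between
    its ends; each of these is at least as long as some arc with chord [q - p] within a half
    circle. *)
Lemma arc_distance_ge p q (x : \bar R) :
  (forall s t, arc_of S (q - p) s t -> (x <= len S s t)%E) ->
  (x <= arc_distance C p q)%E.
Proof.
move=> hx; apply: le_ereal_inf_tmp => _ [v [g [a [b [[ab cg ig ga gb] hg ->]]]]].
have p0 := pi_gt0 R.
have [epq|npq] := eqVneq p q.
  apply: (le_trans (hx 0 0 _)); last by rewrite len_xx curve_length_ge0.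
  by rewrite epq subrr; split; [|lra|rewrite chordxx].
pose h x := - v + g x.
have N1 y : a <= y -> y <= b -> N (h y) = 1.
  move=> ay yb; have : bd (translate v C) (g y).
    by apply: hg; exists y => //; rewrite /= in_itv /= ay yb.
  by move/bd_translate => /(_ C_body C_sym); rewrite /h addrC.
have ab' : a < b.
  by rewrite lt_neqAle ab andbT; apply: contra_neq npq => e; rewrite -ga -gb e.
have [s es] := bdpt_onto C_body C_sym (N1 a (lexx _) ab).
have [|t [st ts et]] := unit_param C_body C_sym (s := s) (N1 b ab (lexx _)).
  rewrite -es /h ga gb; apply: contra_neq npq => /addrI; exact: esym.
have hs y : a < y -> y <= b -> h y != G s.
  move=> ay yb; rewrite -es /h; apply/eqP => /addrI e.
  have : y = a by apply: ig => //; rewrite in_itv /= ?lexx ?ab ?(ltW ay).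
  by move=> ya; move: ay; rewrite ya ltxx.
have cont_h : {within `[a, b], continuous h}.
  by move=> y; apply: cvgD; [exact: cvg_cst|exact: cg].
have e : q - p = G t - G s by rewrite -es -et /h ga gb; vec.
have Lh : cl h a b = cl g a b by rewrite curve_length_translate.
rewrite -Lh.
have l1 : len S (t - pi) (s + pi) = len S t (s + (pi + pi)).
  have hpi : t - pi <= s + pi by lra.
  by rewrite -(lenDpi S hpi) subrK -addrA.
(* The antipode of the complementary arc has the same chord; it replaces an arc that exceeds a half
   circle. *)
have e' : chord S (t - pi) (s + pi) = q - p.
  by rewrite e /chord gamDpi gamBpi opprK addrC.
case: (path_length_ge ab' cont_h N1 hs es et st ts) => hL; apply: le_trans hL.
  have [tp|/ltW tp] := leP t (s + pi).
    by apply: hx; split; [lra|exact: tp|rewrite e].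
  apply: (le_trans (hx (t - pi) (s + pi) _)); last by apply: (@len_mono _ S); lra.
  by split; [lra|lra|exact: e'].
have [tp|/ltW tp] := leP t (s + pi).
  apply: (le_trans (hx s t _)); first by split; [lra|exact: tp|rewrite e].
  rewrite -(lenDpi S (ltW st)); apply: (@len_mono _ S); lra.
apply: (le_trans (hx (t - pi) (s + pi) _)).
  by split; [lra|lra|exact: e'].
by rewrite l1.
Qed.

End ArcDistance.

(** * Points and spindles *)

Section SpindleInequalities.
Context {R : realType} (C : set 'rV[R]_2).
Context (C_body : plane_convex_body C) (C_sym : o_symmetric C).
Local Notation N := (Cnorm C).
Local Notation S := (body_circle C_body C_sym).
Local Notation rho := (arc_distance C).
Implicit Types (x y z : 'rV[R]_2).

Lemma arc_distance_ge0 x y : (0 <= rho x y)%E.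
Proof. by apply: arc_distance_ge => s t [st _ _]; exact: len_ge0. Qed.

(** The two infima are taken one after the other; infinite terms, which cannot be subtracted, are
    treated separately. *)
Lemma le_arc_distanceD x y z (c : \bar R) :
  (forall s t s' t', arc_of S (y - x) s t -> arc_of S (z - y) s' t' ->
    (c <= len S s t + len S s' t')%E) ->
  (c <= rho x y + rho y z)%E.
Proof.
move=> hc.
have key s t : arc_of S (y - x) s t -> (c <= len S s t + rho y z)%E.
  move=> h; have l0 : (0 <= len S s t)%E by case: h => st _ _; exact: len_ge0.
  have [->|li] := eqVneq (len S s t) +oo%E.
    by rewrite addye ?leey // gt_eqF // (lt_le_trans _ (arc_distance_ge0 _ _)) // ltNy0.
  have lf : len S s t \is a fin_num by rewrite ge0_fin_numE // ltey.
  rewrite addeC -leeBlDr //; apply: arc_distance_ge => s' t' h'.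
  by rewrite leeBlDr // addeC; exact: hc.
have r0 := arc_distance_ge0 y z.
have [->|ri] := eqVneq (rho y z) +oo%E.
  by rewrite addey ?leey // gt_eqF // (lt_le_trans _ (arc_distance_ge0 _ _)) // ltNy0.
have rf : rho y z \is a fin_num by rewrite ge0_fin_numE // ltey.
rewrite -leeBlDr //; apply: arc_distance_ge => s t h.
by rewrite leeBlDr //; exact: key.
Qed.

Lemma spindleP x y z :
  spindle C x z y <-> in_spindle S ((y - x) + (z - y)) (y - x).
Proof.
split => [hy a a1 a2|hy v /= [/translateE xv /translateE zv]].
  have /translateE : translate (x - a) C y.
    apply: hy; split; apply/translateE => //.
      by rewrite opprB addrCA subrr addr0.
    by move: a2; congr (N _ <= 1); vec.
  by move=> /(_ C_body C_sym); congr (N _ <= 1); vec.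
apply/translateE => //.
have := hy (x - v) (xv C_body C_sym) _.
rewrite (_ : x - v + ((y - x) + (z - y)) = z - v); last by vec.
rewrite (_ : x - v + (y - x) = y - v); last by vec.
by apply; exact: zv.
Qed.

Lemma spindle_arc_distance_le x y z : spindle C x z y ->
  (rho x y + rho y z <= rho x z)%E.
Proof.
move=> /spindleP hy; apply: arc_distance_ge => w0 w1 hW.
have e : z - x = (y - x) + (z - y) by vec.
rewrite e in hW.
have [s [t [s' [t' [h1 h2 h3]]]]] := spindle_arcs hW hy.
by apply: le_trans h3; apply: leeD; exact: arc_distance_le.
Qed.

Lemma spindle_closed x z : closed (spindle C x z).
Proof. by apply: closed_bigI => v _; exact: translate_closed. Qed.

(** Otherwise the maximum [m] of [N (a + (y - x))] over the compact set of admissible [a] is below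
    1, and all points at [C]-distance less than [1 - m] from [y] lie in the spindle. *)
Lemma not_interior_spindle x y z : N (z - x) <= 2 -> ~ (spindle C x z)° y ->
  exists a, [/\ N a <= 1, N (a + ((y - x) + (z - y))) <= 1 & 1 <= N (a + (y - x))].
Proof.
move=> zx2 hy; apply: contrapT => /forallNP hn; apply: hy.
pose d := z - x.
have e : (y - x) + (z - y) = d by rewrite /d; vec.
rewrite e in hn.
pose K := C `&` [set a | N (a + d) <= 1].
have KP a : K a <-> N a <= 1 /\ N (a + d) <= 1.
  by split => -[/(bodyE C_body C_sym) h1 h2]; split.
have cN (v : 'rV[R]_2) : continuous (fun q : 'rV[R]_2 => N (q + v)).
  rewrite -[v]opprK.
  exact: Cnorm_sub_continuous.
have cK : compact K.
  apply: compact_closedI; first by case: C_body.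
  rewrite (_ : [set _ | _] = (fun q => N (q + d)) @^-1` [set x | x <= 1]) //.
  by apply: closed_comp; [move=> q _; exact: cN|exact: closed_le].
(* The translate centered at the midpoint of [x] and [z] contains both points. *)
have K0 : K !=set0.
  exists (- 2^-1 *: d); apply/KP; split.
    by rewrite CnormZ // normrN ger0_norm; lra.
  rewrite (_ : _ + d = 2^-1 *: d); first by rewrite CnormZ // ger0_norm; lra.
  by apply/rowP => i; rewrite !mxE; field.
have [c] := @EVT_max_rV R _ (fun a => N (a + (y - x))) K K0 cK
  (continuous_subspaceT (cN _)).
rewrite inE => /KP[c1 c2] hmax.
have m1 : N (c + (y - x)) < 1.
  by rewrite ltNge; apply/negP => h; apply: (hn c).
set m := N (c + (y - x)) in hmax m1.
have oD : open ((fun q => N (q - y)) @^-1` [set x | x < 1 - m]).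
  by apply: open_comp; [move=> q _; exact: Cnorm_sub_continuous|exact: open_lt].
have hy0 : ((fun q => N (q - y)) @^-1` [set x | x < 1 - m]) y.
  rewrite /= subrr; have := CnormZ C_body C_sym 0 0.
  by rewrite scale0r normr0 mul0r => ->; lra.
rewrite /interior /=.
have /filterS := open_nbhs_nbhs (conj oD hy0 : open_nbhs y _).
apply => q /= hq v /= [/(translateE C_body C_sym) xv /(translateE C_body C_sym) zv].
apply/translateE => //.
have : N (x - v + (y - x)) <= m.
  apply: hmax; rewrite inE; apply/KP; split => //.
  by rewrite (_ : x - v + d = z - v) // /d; vec.
have := CnormD C_body C_sym (q - y) (x - v + (y - x)).
rewrite (_ : q - y + (x - v + (y - x)) = q - v); last by vec.
lra.
Qed.

Lemma arc_distance_triangle x y z : N (z - x) <= 2 -> ~ (spindle C x z)° y ->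
  (rho x z <= rho x y + rho y z)%E.
Proof.
move=> zx2 hy; apply: le_arc_distanceD => s t s' t' hA hB.
have e : z - x = (y - x) + (z - y) by vec.
have n2 : nrm S ((y - x) + (z - y)) <= 2 by rewrite -e.
have [u [v [h1 h2]]] := sum_arcs n2 (not_interior_spindle zx2 hy) hA hB.
by apply: le_trans h2; apply: arc_distance_le; rewrite e.
Qed.

End SpindleInequalities.

Theorem theorem6 (R : realType) (C : set 'rV[R]_2) (x y z : 'rV[R]_2)
    (C_body : plane_convex_body C) (C_sym : o_symmetric C)
    (xy2 : Cdist C x y <= 2) (yz2 : Cdist C y z <= 2)
    (xz2 : Cdist C x z <= 2) :
  [/\ (spindle C x z)° y ->
        (arc_distance C x y + arc_distance C y z <= arc_distance C x z)%E,
      bd (spindle C x z) y ->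
        (arc_distance C x y + arc_distance C y z = arc_distance C x z)%E &
      ~ spindle C x z y -> smooth C ->
        (arc_distance C x y + arc_distance C y z >= arc_distance C x z)%E].
Proof.
have zx2 : Cnorm C (z - x) <= 2 by rewrite -CnormN // opprB.
split.
- by move=> /interior_subset; exact: spindle_arc_distance_le.
(* The spindle is closed, so a boundary point lies in it but not in its interior, and both
   inequalities apply. *)
- rewrite /bd -(closure_id _).1; last exact: spindle_closed.
  move=> [hy hn]; apply/le_anti; rewrite spindle_arc_distance_le //=.
  exact: arc_distance_triangle.
- move=> hy _; apply: arc_distance_triangle => // /interior_subset; exact: hy.
Qed.
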